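(* Let $(\mathbb{R}^n,g)$ be a pseudo-Euclidean space, $n\ge3$, with coordinates $x=(x_1,\dots,x_n)$ and $g_{ij}=\delta_{ij}\varepsilon_i$, $\varepsilon_i=\pm1$; let $m,r\in\mathbb{N}$ with $m,r\ge1$, and $\xi=\sum_{i=1}^n\alpha_ix_i$ with $\alpha_i\in\mathbb{R}$. Consider smooth functions $f(\xi)$, $h(\xi)$, $\varphi(\xi)$ given in one of the following ways, where in (A) and (B) $k,c_1,c_2,c_3>0$, $c\in\mathbb{R}$, $a=(n-2)k-m$, $b=m(2k+1)-(n-2)k^2$: (A) $\sum_i\varepsilon_i\alpha_i^2=\varepsilon_{i_0}\in\{1,-1\}$, $r\ne1$, $r(k+a)^2\ge(r-1)(a^2-b)$, and, for one choice of sign in $$N_\pm=\frac{r(k+a)\pm\sqrt{r^2(k+a)^2-r(r-1)(a^2-b)}}{r(r-1)},$$ $$f=c_1[(a-rN_\pm)\xi+c]^{-\frac1{a-rN_\pm}},\quad h=c_2[(a-rN_\pm)\xi+c]^{-\frac{N_\pm}{a-rN_\pm}},\quad\varphi=c_3[(a-rN_\pm)\xi+c]^{-\frac{k}{a-rN_\pm}};$$ (B) $\sum_i\varepsilon_i\alpha_i^2=\varepsilon_{i_0}\in\{1,-1\}$, $r=1$, $k+a\ne0$, $N=\frac{a^2-b}{2(k+a)}$, and $$f=c_1[(a-N)\xi+c]^{-\frac1{a-N}},\quad h=c_2[(a-N)\xi+c]^{-\frac{N}{a-N}},\quad\varphi=c_3[(a-N)\xi+c]^{-\frac{k}{a-N}};$$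 (C) $\sum_i\varepsilon_i\alpha_i^2=0$, $f$ and $\varphi$ are any positive smooth functions of $\xi$, and $h$ is a solution of $$-rf\varphi h''-2rf\varphi'h'+[(n-2)f\varphi''-m\varphi f''-2m\varphi'f']h=0.$$ Consider these functions on the subset of $\mathbb{R}^n$ where they are defined and $f(\xi)>0$, $h(\xi)>0$, $\varphi(\xi)\ne0$. Then $(\mathbb{R}^n\times_fF_1^m)\times_hF_2^r$ with metric $\widetilde g=(\overline g\oplus f^2g_{F_1})\oplus h^2g_{F_2}$, where $\overline g=\frac1{\varphi^2}g$, is a Ricci-flat Einstein semi-Riemannian manifold, where $F_1^m$ and $F_2^r$ are Ricci-flat Einstein manifolds of dimensions $m$ and $r$, respectively.
   Context: Primes denote derivatives with respect to $\xi$. $(F_1^m,g_{F_1})$ and $(F_2^r,g_{F_2})$ are semi-Riemannian manifolds. For the open set $U\subset\mathbb{R}^n$ on which the functions are considered, $(\mathbb{R}^n\times_fF_1^m)\times_hF_2^r$ means $U\times F_1\times F_2$ with the metric $\widetilde g$, functions of $\xi$ being pulled back from $U$. In (A) and (B) the exponents are assumed to make sense ($a-rN_\pm\ne0$, respectively $a-N\ne0$) and the functions are defined on the half space where the bracket is positive. *)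

(* Defs.v *)
From mathcomp Require Import all_boot all_order all_algebra.
From mathcomp Require Import all_classical all_reals all_analysis.
Import Order.TTheory GRing.Theory Num.Theory.
Import numFieldNormedType.Exports.

Set Implicit Arguments.
Unset Strict Implicit.
Unset Printing Implicit Defensive.

Local Open Scope classical_set_scope.
Local Open Scope ring_scope.

Section Calculus.
Variables (R : realType) (d : nat).
Implicit Types (F : 'rV[R]_d -> R) (O : set 'rV[R]_d).

Definition partial (i : 'I_d) F : 'rV[R]_d -> R :=
  fun x => 'D_(delta_mx 0 i) F x.

Definition iter_partial (s : seq 'I_d) F := foldr partial F s.

(* F is C^oo on the open set O: all its iterated partial derivatives exist and
   are continuous.  The values of F outside O play no role. *)
Definition smooth_on O F :=
  forall (s : seq 'I_d) (x : 'rV[R]_d), O x ->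
    {for x, continuous (iter_partial s F)} /\
    forall i, derivable (iter_partial s F) x (delta_mx 0 i).

Definition jacobian_matrix (F : 'rV[R]_d -> 'rV[R]_d) (x : 'rV[R]_d) :
    'M[R]_d :=
  \matrix_(i, j) partial i (fun y => F y 0 j) x.

(* Curvature of a metric given by its matrix G in local coordinates. *)
Definition christoffel (G : 'rV[R]_d -> 'M[R]_d) (k i j : 'I_d) :
    'rV[R]_d -> R :=
  fun x => 2^-1 * \sum_(l < d) (invmx (G x)) k l *
    (partial i (fun y => G y j l) x + partial j (fun y => G y i l) x
     - partial l (fun y => G y i j) x).

Definition ricci (G : 'rV[R]_d -> 'M[R]_d) (x : 'rV[R]_d) : 'M[R]_d :=
  let Gam := christoffel G in
  \matrix_(j, k)
   (\sum_(i < d) (partial i (Gam i j k) x - partial k (Gam i i j) x)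
    + \sum_(i < d) \sum_(p < d)
        (Gam i i p x * Gam p j k x - Gam i k p x * Gam p i j x)).

End Calculus.

(* The data of a manifold of dimension d with a metric: a topological space, an
   atlas, and in each chart the matrix (g_ij) of the metric at every point.
   The axioms are in [is_semi_riemannian].  [chart_map a] and [chart_metric a]
   are total functions, but are meaningful only on [chart_dom a]. *)
Record metric_atlas (R : realType) (d : nat) := MetricAtlas {
  point_of :> topologicalType;
  chart : Type;
  chart_dom : chart -> set point_of;
  chart_map : chart -> point_of -> 'rV[R]_d;
  chart_metric : chart -> point_of -> 'M[R]_d }.

Section SemiRiemannian.
Variables (R : realType) (d : nat) (M : metric_atlas R d).
Implicit Types (a b : chart M) (p : M).

(* F \o (chart_map a)^-1, extended by the default value v0 outside
   chart_map a @` chart_dom a. *)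
Definition in_chart (V : choiceType) (v0 : V) a (F : M -> V) : 'rV[R]_d -> V :=
  fun x => xget v0 (F @` (chart_dom a `&` chart_map a @^-1` [set x])).

Definition transition a b : 'rV[R]_d -> 'rV[R]_d := in_chart 0 a (chart_map b).

Definition is_chart a :=
  [/\ open (chart_dom a),
      {in chart_dom a &, injective (chart_map a)},
      {within chart_dom a, continuous (chart_map a)} &
      forall O : set M, open O -> O `<=` chart_dom a ->
        open (chart_map a @` O)].

Definition is_manifold :=
  [/\ hausdorff_space M,
      @second_countable M,
      forall p, exists a, chart_dom a p,
      forall a, is_chart a &
      forall a b j, smooth_on (chart_map a @` (chart_dom a `&` chart_dom b))
                  (fun x => transition a b x 0 j)].

(* The third clause is the transformation law of a (0,2)-tensor; the last one
   says that the index is constant: some diagonal matrix of signs is, in a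
   suitable basis of each tangent space, the matrix of the metric. *)
Definition is_metric :=
  [/\ forall a p, chart_dom a p ->
        (chart_metric a p)^T = chart_metric a p /\ chart_metric a p \in unitmx,
      forall a i j, smooth_on (chart_map a @` chart_dom a)
                              (in_chart 0 a (fun p => chart_metric a p i j)),
      forall a b p, chart_dom a p -> chart_dom b p ->
        let J := jacobian_matrix (transition a b) (chart_map a p) in
        chart_metric a p = J *m chart_metric b p *m J^T &
      exists s : 'I_d -> bool, forall a p, chart_dom a p ->
        exists2 P : 'M[R]_d, P \in unitmx &
          P *m chart_metric a p *m P^T = diag_mx (\row_j (-1) ^+ s j)].

Definition is_semi_riemannian := is_manifold /\ is_metric.

Definition ricci_tensor a p : 'M[R]_d :=
  ricci (in_chart 0 a (chart_metric a)) (chart_map a p).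

Definition einstein :=
  exists lambda : R, forall a p, chart_dom a p ->
    ricci_tensor a p = lambda *: chart_metric a p.

Definition ricci_flat := forall a p, chart_dom a p -> ricci_tensor a p = 0.

End SemiRiemannian.

(* M1 x_f M2: the product manifold with the metric g1 (+) f^2 g2. *)
Definition warped_product (R : realType) (d1 d2 : nat)
    (M1 : metric_atlas R d1) (f : M1 -> R) (M2 : metric_atlas R d2) :
    metric_atlas R (d1 + d2) :=
  @MetricAtlas R (d1 + d2) (M1 * M2)%type (chart M1 * chart M2)%type
    (fun a => chart_dom a.1 `*` chart_dom a.2)
    (fun a p => row_mx (chart_map a.1 p.1) (chart_map a.2 p.2))
    (fun a p => block_mx (chart_metric a.1 p.1) 0
                         0 (f p.1 ^+ 2 *: chart_metric a.2 p.2)).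

(* The subspace U of R^n, with the metric (eps_i delta_ij) / phi^2. *)
Definition conformal_flat (R : realType) (n : nat) (eps : 'I_n -> R)
    (U : set 'rV[R]_n) (phi : 'rV[R]_n -> R) : metric_atlas R n :=
  @MetricAtlas R n (set_type U) unit
    (fun _ => setT)
    (fun _ p => set_val p)
    (fun _ p => (phi (set_val p) ^+ 2)^-1 *: diag_mx (\row_i eps i)).

Section Solutions.
Variables (R : realType) (n m r : nat) (eps alpha : 'I_n -> R).
Implicit Types (I : set R) (f h phi : R -> R).

Definition xi (x : 'rV[R]_n) : R := \sum_i alpha i * x 0 i.

Definition smooth1_on I f :=
  forall (j : nat) t, I t -> derivable (derive1n j f) t 1.

(* f, h, phi are the power functions with denominator D, defined on the whole
   half line I where the bracket is positive. *)
Definition power_functions (D N k c1 c2 c3 c : R) I f h phi :=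
  [/\ D != 0,
      I = [set t | 0 < D * t + c] &
      forall t, I t ->
        [/\ f t = c1 * (D * t + c) `^ (- (1 / D)),
            h t = c2 * (D * t + c) `^ (- (N / D)) &
            phi t = c3 * (D * t + c) `^ (- (k / D))]].

Definition coef_a (k : R) : R := (n%:R - 2) * k - m%:R.
Definition coef_b (k : R) : R := m%:R * (2 * k + 1) - (n%:R - 2) * k ^+ 2.

(* sgn is 1 or -1 *)
Definition N_pm (sgn k a b : R) : R :=
  (r%:R * (k + a)
   + sgn * Num.sqrt (r%:R ^+ 2 * (k + a) ^+ 2
                     - r%:R * (r%:R - 1) * (a ^+ 2 - b)))
  / (r%:R * (r%:R - 1)).

Definition case_A I f h phi :=
  exists k c1 c2 c3 c sgn : R,
    let a := coef_a k in
    let b := coef_b k in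
    let N := N_pm sgn k a b in
    [/\ [/\ 0 < k, 0 < c1, 0 < c2 & 0 < c3],
        exists i0, \sum_i eps i * alpha i ^+ 2 = eps i0,
        r <> 1%N /\ (r%:R - 1) * (a ^+ 2 - b) <= r%:R * (k + a) ^+ 2,
        sgn = 1 \/ sgn = -1 &
        power_functions (a - r%:R * N) N k c1 c2 c3 c I f h phi].

Definition case_B I f h phi :=
  exists k c1 c2 c3 c : R,
    let a := coef_a k in
    let b := coef_b k in
    let N := (a ^+ 2 - b) / (2 * (k + a)) in
    [/\ [/\ 0 < k, 0 < c1, 0 < c2 & 0 < c3],
        exists i0, \sum_i eps i * alpha i ^+ 2 = eps i0,
        r = 1%N,
        k + a != 0 &
        power_functions (a - N) N k c1 c2 c3 c I f h phi].

Definition case_C I f h phi :=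
  [/\ \sum_i eps i * alpha i ^+ 2 = 0,
      open I,
      [/\ smooth1_on I f, smooth1_on I h & smooth1_on I phi],
      forall t, I t -> 0 < f t /\ 0 < phi t &
      forall t, I t ->
        - r%:R * f t * phi t * derive1n 2 h t
        - 2 * r%:R * f t * derive1 phi t * derive1 h t
        + ((n%:R - 2) * f t * derive1n 2 phi t - m%:R * phi t * derive1n 2 f t
           - 2 * m%:R * derive1 phi t * derive1 f t) * h t = 0].

Definition admissible_set I f h phi : set 'rV[R]_n :=
  [set x | [/\ I (xi x), 0 < f (xi x), 0 < h (xi x) & phi (xi x) != 0]].

(* (R^n x_f F1) x_h F2, over the open subset of R^n where it is defined *)
Definition sequential_product (F1 : metric_atlas R m) (F2 : metric_atlas R r)
    I f h phi : metric_atlas R (n + m + r) :=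
  let B := conformal_flat eps (admissible_set I f h phi) (phi \o xi) in
  let BF1 := @warped_product R n m B (fun p => f (xi (set_val p))) F1 in
  @warped_product R (n + m) r BF1 (fun q => h (xi (set_val q.1))) F2.

End Solutions.

(* Main.v *)
Require Import Defs.
From mathcomp Require Import all_boot all_order all_algebra.
From mathcomp Require Import all_classical all_reals all_analysis.
From mathcomp Require Import ring lra.
Import Order.TTheory GRing.Theory Num.Theory.
Import numFieldNormedType.Exports.
Set Implicit Arguments.
Unset Strict Implicit.
Unset Printing Implicit Defensive.
Local Open Scope classical_set_scope.
Local Open Scope ring_scope.

(** The total metric is [rho_c Ghat], where [Ghat] is the product of the flat
    metric [diag(eps)] with [g_F1] and [g_F2], and each of the three blocks [c] is
    rescaled by a function [rho_c] of [xi] alone ([1/phi^2], [f^2], [h^2]).  With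
    [om_c = rho_c' / (2 rho_c)], [be = d xi], [B] the vector dual to [be] and
    [sg_c = rho_c / rho_0], the Christoffel symbols differ from those of [Ghat] by
    the tensor
      [S^k_ij = d_kj om_j be_i + d_ki om_i be_j - sg_i om_i Ghat_ij B^k],
    all mixed terms between [S] and the connection of [Ghat] cancel in the Ricci
    tensor, and with [Om = sum_i om_i]
      [Ric_jk = Ric(Ghat)_jk
         + be_j be_k (2 om_0' - Om' + 2 Om om_0 - 2 om_0^2 - sum_i om_i^2)
         - |alpha|^2 sg_j Ghat_jk (om_j' + om_j (Om - 2 om_0))].
    The first bracket is the equation of case (C).  For power functions
    [om_c = w_c / (D xi + c)] with [w = (k, -1, -N)]; then [Om - 2 om_0] is
    [D / (D xi + c)], so the second bracket vanishes, and the first one becomes the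
    quadratic equation solved by [N]. *)

(** * Smooth functions on open subsets of R^d *)

(** Since [phi], [f] and [h] depend on [xi] alone, the sequential product is handled in one step, as
    a blockwise rescaling of one product metric, rather than by two rounds of warped product
    formulas. The mixed terms cancel for a reason of support. [be] and [B] live in the base block,
    where [Ghat] is constant, so every contraction of the connection of [Ghat] with [be] or [B]
    vanishes. What survives are the traces of that connection times [om_k be_j] and [om_j be_k], and
    these occur once with each sign. The metrics of the fibres stay arbitrary throughout; only their
    Ricci tensors enter, through [Ric(Ghat)]. The analytic obstacle is that a chart metric is a
    total function with a default value off the chart image, and that smoothness is phrased by
    iterated directional derivatives. Identities are therefore proved on open sets and transported
    to derivatives by locality, chain rules are reduced to lines, and the curvature computation
    itself is algebra on values at one point, with the derivatives as independent data. *)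

Section SmoothCalculus.
Variables (R : realType) (d : nat).
Implicit Types (F G : 'rV[R]_d -> R) (O : set 'rV[R]_d).

Definition regular_on O F := forall x, O x ->
  {for x, continuous F} /\ forall i, derivable F x (delta_mx 0 i).

(* [smooth_on] is [ck k] for all [k]; unlike [smooth_on], [ck] allows the
   closure properties to be proved by induction on [k]. *)
Fixpoint ck (k : nat) O F : Prop :=
  regular_on O F /\
  if k is k'.+1 then forall i, ck k' O (partial i F) else True.

Lemma smooth_onP O F : smooth_on O F <-> forall k, ck k O F.
Proof.
split.
  move=> sF k; elim: k F sF => [|k IH] F sF /=; split=> //.
  - by move=> x Ox; exact: (sF [::] x Ox).
  - by move=> x Ox; exact: (sF [::] x Ox).
  - move=> i; apply: IH => s x Ox.
    by have := sF (rcons s i) x Ox; rewrite /iter_partial foldr_rcons.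
move=> cF s; elim/last_ind: s F cF => [|s i IH] F cF x Ox.
  by case: (cF 0%N) => rF _; exact: rF.
rewrite /iter_partial foldr_rcons; apply: IH => // k.
by case: (cF k.+1) => _; exact.
Qed.

Lemma ckW k O F : ck k.+1 O F -> ck k O F.
Proof.
elim: k F => [|k IH] F [rF cF] /=; first by [].
by split=> // i; apply: IH; exact: cF.
Qed.

Lemma smooth_on_subset O O' F : O' `<=` O -> smooth_on O F -> smooth_on O' F.
Proof. by move=> OO' sF s x /OO'; exact: sF. Qed.

Lemma smooth_onW O F : smooth_on O F -> regular_on O F.
Proof. by move=> sF x Ox; exact: (sF [::] x Ox). Qed.

Lemma smooth_on_partial O F i : smooth_on O F -> smooth_on O (partial i F).
Proof.
move=> sF s x Ox.
by have := sF (rcons s i) x Ox; rewrite /iter_partial foldr_rcons.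
Qed.

Lemma near_open O (P : 'rV[R]_d -> Prop) x :
  open O -> O x -> (forall y, O y -> P y) -> \near x, P x.
Proof.
move=> oO Ox OP; have : nbhs x O by exact: open_nbhs_nbhs.
by apply: filterS.
Qed.

Lemma eq_on_partial O F G i : open O -> (forall x, O x -> F x = G x) ->
  forall x, O x -> partial i F x = partial i G x.
Proof.
by move=> oO FG x Ox; apply: near_eq_derive; exact: near_open FG.
Qed.

Lemma eq_on_derivable O F G i x : open O -> (forall x, O x -> F x = G x) ->
  O x -> derivable F x (delta_mx 0 i) -> derivable G x (delta_mx 0 i).
Proof. by move=> oO FG Ox; apply: near_eq_derivable; exact: near_open FG. Qed.

Lemma eq_on_regular O F G : open O -> (forall x, O x -> F x = G x) ->
  regular_on O F -> regular_on O G.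
Proof.
move=> oO FG rF x Ox; have [cFx dFx] := rF x Ox.
split=> [|i]; last exact: (eq_on_derivable oO FG Ox (dFx i)).
rewrite /prop_for /continuous_at -(FG _ Ox); apply: cvg_trans cFx.
have nFG := near_open oO Ox FG.
have FF : Filter (nbhs x) by exact: nbhs_filter.
by apply: (@near_eq_cvg _ _ (nbhs x) FF); apply: filterS nFG => y ->.
Qed.

Lemma eq_on_ck k O F G : open O -> (forall x, O x -> F x = G x) ->
  ck k O F -> ck k O G.
Proof.
move=> oO; elim: k F G => [|k IH] F G FG [rF cF].
  by split; [exact: eq_on_regular oO FG rF|].
split=> [|i]; first exact: eq_on_regular oO FG rF.
exact: IH (eq_on_partial _ oO FG) (cF i).
Qed.

Lemma eq_on_smooth O F G : open O -> (forall x, O x -> F x = G x) ->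
  smooth_on O F -> smooth_on O G.
Proof.
by move=> oO FG /smooth_onP sF; apply/smooth_onP => k; exact: eq_on_ck oO FG (sF k).
Qed.

Lemma partial_cst (c : R) i : partial i (fun _ : 'rV[R]_d => c) = fun=> 0.
Proof. by apply/funext => x; rewrite /partial derive_cst. Qed.

Lemma smooth_on_cst O (c : R) : smooth_on O (fun=> c).
Proof.
have reg c' : regular_on O (fun=> c').
  move=> x _; split=> [|i]; last exact: derivable_cst.
  exact: (@cst_continuous _ _ c').
apply/smooth_onP => k; elim: k c => [|k IH] c; split; [exact: reg|by []|exact: reg|].
by move=> i; rewrite partial_cst; exact: IH.
Qed.

Lemma partialD F G i x : derivable F x (delta_mx 0 i) ->
  derivable G x (delta_mx 0 i) ->
  partial i (fun y => F y + G y) x = partial i F x + partial i G x.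
Proof. exact: deriveD. Qed.

Lemma partialM F G i x : derivable F x (delta_mx 0 i) ->
  derivable G x (delta_mx 0 i) ->
  partial i (fun y => F y * G y) x = partial i F x * G x + F x * partial i G x.
Proof.
move=> dF dG; rewrite /partial (deriveM dF dG).
by rewrite addrC /GRing.scale /= [G x * _]mulrC.
Qed.

Lemma partialV F i x : F x != 0 -> derivable F x (delta_mx 0 i) ->
  partial i (fun y => (F y)^-1) x = - ((F x)^-1 * (F x)^-1 * partial i F x).
Proof.
move=> F0 dF; rewrite /partial (deriveV F0 dF).
by rewrite /GRing.scale /= expr2 invfM mulNr.
Qed.

Lemma ckD k O F G : open O -> ck k O F -> ck k O G ->
  ck k O (fun x => F x + G x).
Proof.
move=> oO; have reg F' G' : regular_on O F' -> regular_on O G' ->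
    regular_on O (fun x => F' x + G' x).
  move=> rF rG x Ox; have [cFx dFx] := rF x Ox; have [cGx dGx] := rG x Ox.
  by split=> [|i]; [exact: (@continuousD _ _ _ F' G')|exact: derivableD].
elim: k F G => [|k IH] F G [rF cF] [rG cG].
  by split; [exact: reg|].
split=> [|i]; first exact: reg.
apply: (eq_on_ck oO _ (IH _ _ (cF i) (cG i))) => x Ox.
by rewrite (partialD (proj2 (rF x Ox) i) (proj2 (rG x Ox) i)).
Qed.

Lemma ckM k O F G : open O -> ck k O F -> ck k O G ->
  ck k O (fun x => F x * G x).
Proof.
move=> oO; have reg F' G' : regular_on O F' -> regular_on O G' ->
    regular_on O (fun x => F' x * G' x).
  move=> rF rG x Ox; have [cFx dFx] := rF x Ox; have [cGx dGx] := rG x Ox.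
  by split=> [|i]; [exact: (@continuousM _ _ F' G')|exact: derivableM].
elim: k F G => [|k IH] F G cF0 cG0; case: (cF0) (cG0) => rF cF [rG cG].
  by split; [exact: reg|].
split=> [|i]; first exact: reg.
(* In the Leibniz rule one factor stays undifferentiated; it is known at order [k.+1] and has to be
   lowered to order [k] before the induction hypothesis applies. *)
have := ckD oO (IH _ _ (cF i) (ckW cG0)) (IH _ _ (ckW cF0) (cG i)).
apply: (eq_on_ck oO) => x Ox.
by rewrite (partialM (proj2 (rF x Ox) i) (proj2 (rG x Ox) i)).
Qed.

Lemma smooth_onD O F G : open O -> smooth_on O F -> smooth_on O G ->
  smooth_on O (fun x => F x + G x).
Proof.
by move=> oO /smooth_onP sF /smooth_onP sG; apply/smooth_onP => k;
  exact: (ckD oO (sF k) (sG k)).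
Qed.

Lemma smooth_onM O F G : open O -> smooth_on O F -> smooth_on O G ->
  smooth_on O (fun x => F x * G x).
Proof.
by move=> oO /smooth_onP sF /smooth_onP sG; apply/smooth_onP => k;
  exact: (ckM oO (sF k) (sG k)).
Qed.

Lemma smooth_onN O F : open O -> smooth_on O F -> smooth_on O (fun x => - F x).
Proof.
move=> oO sF; have := smooth_onM oO (@smooth_on_cst O (-1)) sF.
by apply: (eq_on_smooth oO) => x _; rewrite mulN1r.
Qed.

Lemma smooth_onB O F G : open O -> smooth_on O F -> smooth_on O G ->
  smooth_on O (fun x => F x - G x).
Proof. by move=> oO sF sG; exact: (smooth_onD oO sF (smooth_onN oO sG)). Qed.

Lemma smooth_onX O F n : open O -> smooth_on O F ->
  smooth_on O (fun x => F x ^+ n).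
Proof.
move=> oO sF; elim: n => [|n IH]; first exact: smooth_on_cst.
by apply: (eq_on_smooth oO _ (smooth_onM oO sF IH)) => x _; rewrite exprS.
Qed.

Lemma smooth_on_sum O (J : Type) (s : seq J) (P : pred J)
    (F : J -> 'rV[R]_d -> R) : open O -> (forall j, smooth_on O (F j)) ->
  smooth_on O (fun x => \sum_(j <- s | P j) F j x).
Proof.
move=> oO sF; elim: s => [|j s IH].
  by apply: (eq_on_smooth oO _ (@smooth_on_cst O 0)) => x _; rewrite big_nil.
have sFj : smooth_on O (fun x => if P j then F j x else 0).
  by case: (P j); [exact: sF|exact: smooth_on_cst].
apply: (eq_on_smooth oO _ (smooth_onD oO sFj IH)) => x _.
by rewrite big_cons; case: (P j); rewrite ?add0r.
Qed.

Lemma smooth_on_prod O (J : Type) (s : seq J) (P : pred J)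
    (F : J -> 'rV[R]_d -> R) : open O -> (forall j, smooth_on O (F j)) ->
  smooth_on O (fun x => \prod_(j <- s | P j) F j x).
Proof.
move=> oO sF; elim: s => [|j s IH].
  by apply: (eq_on_smooth oO _ (@smooth_on_cst O 1)) => x _; rewrite big_nil.
have sFj : smooth_on O (fun x => if P j then F j x else 1).
  by case: (P j); [exact: sF|exact: smooth_on_cst].
apply: (eq_on_smooth oO _ (smooth_onM oO sFj IH)) => x _.
by rewrite big_cons; case: (P j); rewrite ?mul1r.
Qed.

(** The derivative [- F^-2 F'] involves the inverse itself, but only at the lower order supplied by
    the induction hypothesis. *)
Lemma ckV k O F : open O -> (forall x, O x -> F x != 0) -> ck k O F ->
  ck k O (fun x => (F x)^-1).
Proof.
move=> oO F0.
have reg : regular_on O F -> regular_on O (fun x => (F x)^-1).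
  move=> rF x Ox; have [cFx dFx] := rF x Ox; have F0x := F0 x Ox.
  by split=> [|i]; [exact: (continuousV F0x cFx)|exact: (derivableV F0x (dFx i))].
elim: k => [|k IH] cF0; case: (cF0) => rF cF.
  by split; [exact: reg|].
split=> [|i]; first exact: reg.
have iF := IH (ckW cF0).
have cm1 := (proj1 (smooth_onP _ _) (@smooth_on_cst O (-1))) k.
apply: (eq_on_ck oO _ (ckM oO cm1 (ckM oO (ckM oO iF iF) (cF i)))) => x Ox.
by rewrite (partialV (F0 x Ox) (proj2 (rF x Ox) i)) mulN1r.
Qed.

Lemma smooth_onV O F : open O -> (forall x, O x -> F x != 0) -> smooth_on O F ->
  smooth_on O (fun x => (F x)^-1).
Proof.
by move=> oO F0 /smooth_onP sF; apply/smooth_onP => k; exact: (ckV oO F0 (sF k)).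
Qed.

Lemma smooth_on_det O n (A : 'rV[R]_d -> 'M[R]_n) : open O ->
  (forall i j, smooth_on O (fun x => A x i j)) ->
  smooth_on O (fun x => \det (A x)).
Proof.
move=> oO sA; apply: (smooth_on_sum _ _ oO) => s.
by apply: (smooth_onM oO (@smooth_on_cst _ _)); apply: (smooth_on_prod _ _ oO).
Qed.

(** Cramer's rule: the entries of the inverse are signed minors over the determinant, hence rational
    in the entries of the matrix. *)
Lemma smooth_on_invmx O n (A : 'rV[R]_d -> 'M[R]_n) : open O ->
  (forall x, O x -> A x \in unitmx) ->
  (forall i j, smooth_on O (fun x => A x i j)) ->
  forall i j, smooth_on O (fun x => invmx (A x) i j).
Proof.
move=> oO uA sA i j.
have sV : smooth_on O (fun x => (\det (A x))^-1).
  apply: (smooth_onV oO _ (smooth_on_det oO sA)) => x /uA.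
  by rewrite unitmxE unitfE.
have sC : smooth_on O (fun x => \det (row' j (col' i (A x)))).
  apply: (smooth_on_det oO) => i' j'.
  by apply: (eq_on_smooth oO _ (sA (lift j i') (lift i j'))) => x _; rewrite !mxE.
have := smooth_onM oO sV (smooth_onM oO (@smooth_on_cst _ ((-1) ^+ (j + i))) sC).
by apply: (eq_on_smooth oO) => x Ox; rewrite /invmx uA// !mxE.
Qed.

Lemma smooth_on_christoffel O (G : 'rV[R]_d -> 'M[R]_d) : open O ->
  (forall x, O x -> G x \in unitmx) ->
  (forall i j, smooth_on O (fun x => G x i j)) ->
  forall k i j, smooth_on O (christoffel G k i j).
Proof.
move=> oO uG sG k i j; apply: (smooth_onM oO (@smooth_on_cst _ _)).
apply: (smooth_on_sum _ _ oO) => l.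
have sP i' j' k' := @smooth_on_partial _ _ i' (sG j' k').
apply: (smooth_onM oO (smooth_on_invmx oO uG sG k l)).
exact: (smooth_onB oO (smooth_onD oO (sP _ _ _) (sP _ _ _)) (sP _ _ _)).
Qed.

Lemma eq_on_christoffel O (G H : 'rV[R]_d -> 'M[R]_d) : open O ->
  (forall x, O x -> G x = H x) ->
  forall k i j x, O x -> christoffel G k i j x = christoffel H k i j x.
Proof.
move=> oO GH k i j x Ox.
have E a i' j' :
    partial a (fun y => G y i' j') x = partial a (fun y => H y i' j') x.
  by apply: (eq_on_partial _ oO) Ox => y Oy; rewrite GH.
rewrite /christoffel (GH x Ox).
by under eq_bigr do rewrite (E i) (E j) E.
Qed.

(** The coordinate formula of the Ricci tensor, with the derivatives of the Christoffel symbols as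
    separate arguments, so that curvature identities become pointwise algebra. *)
Definition ricci_of (dGam : 'I_d -> 'I_d -> 'I_d -> 'I_d -> R)
    (Gam : 'I_d -> 'I_d -> 'I_d -> R) (j k : 'I_d) : R :=
  \sum_(i < d) (dGam i i j k - dGam k i i j)
  + \sum_(i < d) \sum_(p < d) (Gam i i p * Gam p j k - Gam i k p * Gam p i j).

Lemma ricciE (G : 'rV[R]_d -> 'M[R]_d) x j k : ricci G x j k =
  ricci_of (fun a k i j => partial a (christoffel G k i j) x)
           (fun k i j => christoffel G k i j x) j k.
Proof. by rewrite /ricci mxE. Qed.

(** Curvature is local: this lets a chart metric, meaningful only on the chart image, be replaced by
    an explicit formula valid there. *)
Lemma eq_on_ricci O (G H : 'rV[R]_d -> 'M[R]_d) : open O ->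
  (forall x, O x -> G x = H x) -> forall x, O x -> ricci G x = ricci H x.
Proof.
move=> oO GH x Ox; have eG := eq_on_christoffel oO GH.
apply/matrixP => j k.
rewrite (ricciE G).
rewrite (ricciE H).
apply: (congr2 (fun a b => ricci_of a b j k)).
  apply/funext => a; apply/funext => k'; apply/funext => i; apply/funext => j'.
  exact: (eq_on_partial _ oO (eG k' i j')) Ox.
by apply/funext => k'; apply/funext => i; apply/funext => j'; exact: eG.
Qed.

End SmoothCalculus.

(** * Functions of a linear form *)

Section Functional.
Variables (R : realType) (d : nat) (beta : 'I_d -> R).
Implicit Types (F : R -> R) (I : set R).

Lemma xi_shift x i (t : R) : xi beta (t *: delta_mx 0 i + x) = t * beta i + xi beta x.
Proof.
rewrite /xi (eq_bigr (fun j => t * (beta j * (i == j)%:R) + beta j * x 0 j)).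
  rewrite big_split /= -mulr_sumr (bigD1 i) //= eqxx mulr1 big1 ?addr0 //.
  by move=> j /negPf ji; rewrite eq_sym ji mulr0.
by move=> j _; rewrite !mxE eqxx /= mulrDr eq_sym mulrCA.
Qed.

Lemma continuous_xi : continuous (xi beta).
Proof.
have H (s : seq 'I_d) :
    continuous (fun x : 'rV[R]_d => \sum_(i <- s) beta i * x 0 i : R).
  elim: s => [|i s IH] x.
    have -> : (fun x : 'rV[R]_d => \sum_(i <- [::]) beta i * x 0 i) = cst 0.
      by apply/funext => y; rewrite big_nil.
    exact: cst_continuous.
  have ci : {for x, continuous (fun y : 'rV[R]_d => beta i * y 0 i : R)}.
    apply: (@continuousM _ _ (cst (beta i)) (fun y : 'rV[R]_d => y 0 i)).
      exact: cst_continuous.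
    exact: coord_continuous.
  have -> : (fun y : 'rV[R]_d => \sum_(j <- i :: s) beta j * y 0 j) =
      (fun y => beta i * y 0 i + \sum_(j <- s) beta j * y 0 j).
    by apply/funext => y; rewrite big_cons.
  exact: (continuousD ci (IH x)).
exact: H.
Qed.

(** A directional derivative only sees a line, and along the line through [x] in direction [i] the
    form [xi beta] is the affine function [g]; the one-variable chain rule suffices. *)
Lemma is_derive_xi F x i : derivable F (xi beta x) 1 ->
  is_derive x (delta_mx 0 i : 'rV[R]_d) (F \o xi beta) (beta i * derive1 F (xi beta x)).
Proof.
move=> dF.
pose g := fun t : R => t * beta i + xi beta x.
have E (t : R) : (F \o xi beta) (t *: delta_mx 0 i + x) = (F \o g) t.
  by rewrite /= xi_shift.
have dg : is_derive (0 : R) (1 : R) g (beta i).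
  rewrite /g; apply: is_derive_eq; rewrite /GRing.scale/=; ring.
have g0 : g 0 = xi beta x by rewrite /g mul0r add0r.
have dFg : derivable (F \o g) 0 1.
  apply/derivable1_diffP; apply: differentiable_comp.
    by apply/derivable1_diffP; exact: ex_derive.
  by rewrite g0; apply/derivable1_diffP.
apply: DeriveDef.
  by apply/derivable1P; under eq_fun do rewrite E; exact: dFg.
have -> : 'D_(delta_mx 0 i) (F \o xi beta) x = 'D_1 (F \o g) 0.
  rewrite /derive; set A := fun h => _; set B := fun h => _.
  suff -> : A = B by [].
  apply/funext => t; rewrite /A /B /= xi_shift addr0 /g mul0r add0r.
  by rewrite [_%:A]mulr1.
rewrite -derive1E derive1_comp; first by rewrite g0 mulrC (derive1E g) derive_val.
  exact: ex_derive.
rewrite g0; exact: dF.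
Qed.

Lemma partial_xi F x i : derivable F (xi beta x) 1 ->
  partial i (F \o xi beta) x = beta i * derive1 F (xi beta x).
Proof. by move=> /is_derive_xi dF; rewrite /partial derive_val. Qed.

Lemma derivable_xi F x i : derivable F (xi beta x) 1 ->
  derivable (F \o xi beta) x (delta_mx 0 i : 'rV[R]_d).
Proof. by move=> /is_derive_xi dF; exact: ex_derive. Qed.

Lemma open_xi I : open I -> open (xi beta @^-1` I).
Proof. by move=> oI; apply: open_comp => // x _; exact: continuous_xi. Qed.

Lemma smooth1_on_derive1 I F : smooth1_on I F -> smooth1_on I (derive1 F).
Proof. by move=> sF j t It; rewrite -derive1Sn; exact: sF. Qed.

Lemma derivable_continuous1 F t : derivable F t 1 -> {for t, continuous F}.
Proof. by move=> /derivable1_diffP; exact: differentiable_continuous. Qed.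

Lemma smooth_on_xi I F : open I -> smooth1_on I F ->
  smooth_on (xi beta @^-1` I) (F \o xi beta).
Proof.
move=> oI sF; apply/smooth_onP => k.
have reg G : smooth1_on I G -> regular_on (xi beta @^-1` I) (G \o xi beta).
  move=> sG x Ix; have dG := sG 0%N _ Ix; split=> [|i]; last exact: derivable_xi.
  by apply: continuous_comp; [exact: continuous_xi|exact: derivable_continuous1].
elim: k F sF => [|k IH] F sF; first by split; [exact: reg|].
split=> [|i]; first exact: reg.
have oX := open_xi oI.
have cb := (proj1 (smooth_onP _ _) (@smooth_on_cst R d (xi beta @^-1` I) (beta i))) k.
apply: (eq_on_ck oX _ (ckM oX cb (IH _ (smooth1_on_derive1 sF)))) => x Ix.
by rewrite partial_xi //; exact: (sF 0%N).
Qed.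

End Functional.

(** * The Ricci tensor of a connection perturbed by [S] *)

(* All data are values at one point: [Gam] is the connection of the block
   diagonal metric [H], [dGam] and [dH] are first derivatives, [c] assigns to
   each index its block, and [t0] is the block that carries [be] and [B]. *)
Section RicciAlgebra.
Variables (R : realType) (d : nat) (T : eqType) (c : 'I_d -> T) (t0 : T).
Variables (H : 'I_d -> 'I_d -> R) (dH : 'I_d -> 'I_d -> 'I_d -> R).
Variables (Gam : 'I_d -> 'I_d -> 'I_d -> R).
Variables (dGam : 'I_d -> 'I_d -> 'I_d -> 'I_d -> R).
Variables (be B : 'I_d -> R) (om dom ta dta : T -> R).
Hypothesis Hsym : forall i j, H i j = H j i.
Hypothesis Hblock : forall i j, c i != c j -> H i j = 0.
Hypothesis dHflat : forall a i j, c a = t0 \/ c i = t0 -> dH a i j = 0.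
Hypothesis Gsym : forall k i j, Gam k i j = Gam k j i.
Hypothesis Gblock : forall k i j, c k != c i -> Gam k i j = 0.
Hypothesis Gflat : forall k i j, c k = t0 -> Gam k i j = 0.
Hypothesis be0 : forall i, c i != t0 -> be i = 0.
Hypothesis B0 : forall i, c i != t0 -> B i = 0.
Hypothesis BH : forall p, \sum_i B i * H i p = be p.
Hypothesis ta0 : ta t0 = om t0.
Hypothesis dta0 : dta t0 = dom t0.

(** [ta] stands for [sg_c om_c]. It is kept independent of [om], tied to it only on the block [t0],
    where the ratio [sg] is 1. *)
Definition conf_tensor (k i j : 'I_d) : R :=
  (k == j)%:R * (om (c j) * be i) + (k == i)%:R * (om (c i) * be j)
  - ta (c i) * H i j * B k.

(** The derivative of [conf_tensor] along coordinate [a]: each function of [xi] yields a factor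
    [be a] by the chain rule, [be] and [B] are constant, and [H] is differentiated by [dH]. *)
Definition dconf_tensor (a k i j : 'I_d) : R :=
  (k == j)%:R * (dom (c j) * be a * be i)
  + (k == i)%:R * (dom (c i) * be a * be j)
  - (dta (c i) * be a * H i j + ta (c i) * dH a i j) * B k.

Local Notation S := conf_tensor.
Local Notation dS := dconf_tensor.

Lemma sum_delta (F : 'I_d -> R) k : \sum_p (p == k)%:R * F p = F k.
Proof.
rewrite (bigD1 k) //= eqxx mul1r big1 ?addr0 // => p /negPf ->.
by rewrite mul0r.
Qed.

(** [be] is supported in the block [t0], so next to it any function of the block may be evaluated at
    [t0]. This, with its analogue for [B], is what reduces all coefficients of [be j * be k] to the
    base block. *)
Lemma be_class (F : T -> R) i : be i * F (c i) = be i * F t0.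
Proof. by have [->//|/be0->] := eqVneq (c i) t0; rewrite !mul0r. Qed.

Lemma B_class (F : T -> R) i : B i * F (c i) = B i * F t0.
Proof. by have [->//|/B0->] := eqVneq (c i) t0; rewrite !mul0r. Qed.

Lemma sum_BH (F : T -> R) p : \sum_i F (c i) * (B i * H i p) = F t0 * be p.
Proof.
rewrite -BH mulr_sumr; apply: eq_bigr => i _.
by rewrite mulrA [F _ * _]mulrC B_class; ring.
Qed.

Lemma sum_HB (F : T -> R) p : \sum_i F (c i) * (H p i * B i) = F t0 * be p.
Proof. by rewrite -sum_BH; apply: eq_bigr => i _; rewrite Hsym [H _ _ * _]mulrC. Qed.

Lemma sum_HB1 p : \sum_i H p i * B i = be p.
Proof. by rewrite -BH; apply: eq_bigr => i _; rewrite Hsym mulrC. Qed.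

Let eps := \sum_p be p * B p.

Lemma contract_conf (X : 'I_d -> R) j k : \sum_p X p * S p j k =
  X k * (om (c k) * be j) + X j * (om (c j) * be k)
  - ta (c j) * H j k * \sum_p X p * B p.
Proof.
rewrite (eq_bigr (fun p => (p == k)%:R * (X p * (om (c k) * be j))
  + (p == j)%:R * (X p * (om (c j) * be k))
  - ta (c j) * H j k * (X p * B p))); last by move=> p _; rewrite /S; ring.
by rewrite sumrB big_split /= !sum_delta -mulr_sumr.
Qed.

Lemma conf_sym k i j : S k i j = S k j i.
Proof.
rewrite /S [H j i]Hsym.
have -> : ta (c i) * H i j = ta (c j) * H i j.
  by have [->//|/Hblock->] := eqVneq (c i) (c j); rewrite !mulr0.
by ring.
Qed.

Let Om := \sum_i om (c i).
Let dOm := \sum_i dom (c i).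
Let Om2 := \sum_i om (c i) ^+ 2.

(** The first and the third term of the tensor contribute [om t0 * be p] and [ta t0 * be p] with
    opposite signs, and these agree. *)
Lemma trace_conf p : \sum_i S i i p = Om * be p.
Proof.
rewrite (eq_bigr (fun i => (i == p)%:R * (om (c p) * be i)
  + om (c i) * be p - ta (c i) * (B i * H i p))); last first.
  by move=> i _; rewrite /S eqxx /=; ring.
rewrite sumrB big_split /= sum_delta -mulr_suml sum_BH ta0.
by rewrite [om (c p) * _]mulrC be_class /Om; ring.
Qed.

(** Either the upper index lies in the flat block and the symbol vanishes, or it does not and [be]
    vanishes. *)
Lemma beGam i j k : be i * Gam i j k = 0.
Proof. by have [/Gflat->|/be0->] := eqVneq (c i) t0; rewrite ?mulr0 ?mul0r. Qed.

(** A nonzero [B k] puts the lower index [k] in the flat block; by symmetry and block structure the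
    upper index is then there as well, where the symbols vanish. *)
Lemma GamB i j k : Gam i j k * B k = 0.
Proof.
have [ck|/B0->] := eqVneq (c k) t0; last by rewrite mulr0.
rewrite Gsym; have [cik|/Gblock->] := eqVneq (c i) (c k); last by rewrite mul0r.
by rewrite Gflat ?mul0r // cik.
Qed.

(** Of the three terms of the tensor two are killed by [beGam] and [GamB], and the remaining one
    leaves a trace of the connection. *)
Lemma cross_conf j k :
  \sum_i \sum_p Gam i k p * S p i j = (\sum_i Gam i i k) * (om (c k) * be j).
Proof.
rewrite mulr_suml; apply: eq_bigr => i _; rewrite contract_conf.
rewrite big1 => [|p _]; last exact: GamB.
rewrite mulr0 subr0.
have -> : Gam i k j * (om (c j) * be i) = om (c j) * (be i * Gam i k j) by ring.
rewrite beGam mulr0 add0r [Gam i i k]Gsym.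
by have [->//|/Gblock->] := eqVneq (c i) (c k); rewrite !mul0r.
Qed.

Lemma cross_conf' j k :
  \sum_i \sum_p S i k p * Gam p i j = (\sum_i Gam i i j) * (om (c j) * be k).
Proof.
rewrite -cross_conf exchange_big /=; apply: eq_bigr => i _; apply: eq_bigr => p _.
by rewrite mulrC [Gam i j p]Gsym [S p i k]conf_sym.
Qed.

Lemma square_conf j k : \sum_i \sum_p S i k p * S p i j =
  (2 * om t0 ^+ 2 + Om2) * (be j * be k)
  - 2 * eps * (ta (c k) * om (c k)) * H k j.
Proof.
under eq_bigr do rewrite contract_conf.
rewrite sumrB big_split /=.
have -> : \sum_i S i k j * (om (c j) * be i) =
    om (c j) * (be j * (om (c j) * be k) + be k * (om (c k) * be j)
    - ta (c k) * H k j * eps).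
  rewrite -contract_conf mulr_sumr; apply: eq_bigr => i _; ring.
have -> : \sum_i S i k i * (om (c i) * be j) = Om2 * (be k * be j)
    + om (c k) ^+ 2 * (be k * be j)
    - ta (c k) * be j * \sum_i om (c i) * (H k i * B i).
  rewrite (eq_bigr (fun i => om (c i) ^+ 2 * (be k * be j)
    + (i == k)%:R * (om (c k) * be i * om (c i) * be j)
    - ta (c k) * be j * (om (c i) * (H k i * B i)))); last first.
    by move=> i _; rewrite /S eqxx /=; ring.
  rewrite sumrB big_split /= sum_delta -mulr_suml -mulr_sumr /Om2; ring.
have E i : \sum_p S i k p * B p = om (c i) * be k * B i
    + (i == k)%:R * (om (c k) * eps) - ta (c k) * be k * B i.
  rewrite (eq_bigr (fun p => (p == i)%:R * (om (c p) * be k * B p)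
    + (i == k)%:R * om (c k) * (be p * B p)
    - ta (c k) * B i * (H k p * B p))); last first.
    by move=> p _; rewrite /S eq_sym; ring.
  rewrite sumrB big_split /= sum_delta -!mulr_sumr sum_HB1 /eps; ring.
have -> : \sum_i ta (c i) * H i j * (\sum_p S i k p * B p) =
    be k * (\sum_i (ta (c i) * om (c i)) * (B i * H i j))
    + ta (c k) * H k j * (om (c k) * eps)
    - ta (c k) * be k * \sum_i ta (c i) * (B i * H i j).
  rewrite (eq_bigr (fun i => be k * ((ta (c i) * om (c i)) * (B i * H i j))
    + (i == k)%:R * (ta (c i) * H i j * (om (c k) * eps))
    - ta (c k) * be k * (ta (c i) * (B i * H i j)))); last first.
    by move=> i _; rewrite E; ring.
  by rewrite sumrB big_split /= sum_delta -!mulr_sumr.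
rewrite (sum_BH (fun t => ta t * om t)) sum_BH sum_HB ta0.
have bk := be_class (fun t => om t) k; have bj := be_class (fun t => om t) j.
have bk2 := be_class (fun t => om t ^+ 2) k.
have bj2 := be_class (fun t => om t ^+ 2) j.
have btk := be_class ta k; rewrite ta0 in btk.
(* Next to [H k j] the two indices may be taken in the same block. *)
have Hom : ta (c k) * H k j * om (c j) = ta (c k) * H k j * om (c k).
  by have [->//|/Hblock->] := eqVneq (c k) (c j); rewrite !mulr0 !mul0r.
rewrite (_ : om (c j) * _ = be k * (be j * om (c j) ^+ 2)
  + (be k * om (c k)) * (be j * om (c j))
  - eps * (ta (c k) * H k j * om (c j))); last by ring.
rewrite Hom bj2 bk bj.
rewrite (_ : om (c k) ^+ 2 * _ = be j * (be k * om (c k) ^+ 2)); last by ring.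
rewrite bk2.
rewrite (_ : ta (c k) * be j * _ = om t0 * be j * (be k * ta (c k))); last by ring.
rewrite [ta (c k) * be k]mulrC !btk; ring.
Qed.

Lemma div_conf j k : \sum_i (dS i i j k - dS k i i j) =
  (2 * dom t0 - dOm) * (be j * be k) - dta (c j) * H j k * eps.
Proof.
rewrite sumrB.
have -> : \sum_i dS i i j k = dom (c k) * be k * be j + dom (c j) * be j * be k
    - dta (c j) * H j k * eps.
  rewrite (eq_bigr (fun i => (i == k)%:R * (dom (c k) * be i * be j)
    + (i == j)%:R * (dom (c j) * be i * be k)
    - dta (c j) * H j k * (be i * B i))); last first.
    move=> i _; rewrite /dS.
    have -> : (dta (c j) * be i * H j k + ta (c j) * dH i j k) * B i =
        dta (c j) * H j k * (be i * B i) + ta (c j) * (dH i j k * B i) by ring.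
    (* [B] restricts the direction of differentiation to the flat block, along which no entry of [H]
       varies. *)
    have -> : dH i j k * B i = 0.
      have [ci|/B0->] := eqVneq (c i) t0; last by rewrite mulr0.
      by rewrite dHflat ?mul0r //; left.
    by rewrite mulr0 addr0.
  by rewrite sumrB big_split /= !sum_delta -mulr_sumr.
have -> : \sum_i dS k i i j = dom (c j) * be k * be j + dOm * (be k * be j)
    - be k * \sum_i dta (c i) * (B i * H i j).
  rewrite (eq_bigr (fun i => (i == j)%:R * (dom (c j) * be k * be i)
    + dom (c i) * (be k * be j)
    - be k * (dta (c i) * (B i * H i j)))); last first.
    move=> i _; rewrite /dS eqxx /=.
    have -> : (dta (c i) * be k * H i j + ta (c i) * dH k i j) * B i =
        be k * (dta (c i) * (B i * H i j)) + ta (c i) * (dH k i j * B i) by ring.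
    (* Here [B] restricts a matrix index instead: the rows of [H] in the flat block are constant. *)
    have -> : dH k i j * B i = 0.
      have [ci|/B0->] := eqVneq (c i) t0; last by rewrite mulr0.
      by rewrite dHflat ?mul0r //; right.
    by rewrite mulr0 addr0; ring.
  by rewrite sumrB big_split /= sum_delta -mulr_suml -mulr_sumr.
rewrite sum_BH dta0.
have bk := be_class dom k; have bj := be_class dom j.
rewrite (_ : dom (c k) * be k * be j = be j * (be k * dom (c k))); last by ring.
rewrite bk.
rewrite (_ : dom (c j) * be j * be k = be k * (be j * dom (c j))); last by ring.
rewrite (_ : dom (c j) * be k * be j = be k * (be j * dom (c j))); last by ring.
rewrite bj; ring.
Qed.

(** The quadratic part expands into seven sums. The traces of [Gam] produced by [cross_conf] and
    [cross_conf'] cancel those of the product of the trace of [Gam] with [S], the product of the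
    trace of [S] with [Gam] is zero by [beGam], and only terms in [S] alone are added to the
    curvature of [Gam]. *)
Lemma ricci_of_conf j k :
  ricci_of (fun a k i j => dGam a k i j + dS a k i j)
           (fun k i j => Gam k i j + S k i j) j k =
  ricci_of dGam Gam j k
  + be j * be k * (2 * dom t0 - dOm + 2 * Om * om t0 - 2 * om t0 ^+ 2 - Om2)
  - eps * H j k * (dta (c j) + Om * ta (c j) - 2 * ta (c j) * om (c j)).
Proof.
rewrite /ricci_of.
rewrite (eq_bigr (fun i => (dGam i i j k - dGam k i i j)
  + (dS i i j k - dS k i i j))); last by move=> i _; ring.
rewrite big_split /= div_conf.
have -> : \sum_i \sum_p ((Gam i i p + S i i p) * (Gam p j k + S p j k)
      - (Gam i k p + S i k p) * (Gam p i j + S p i j)) =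
    \sum_i \sum_p (Gam i i p * Gam p j k - Gam i k p * Gam p i j)
    + (\sum_p (\sum_i Gam i i p) * S p j k)
    + (\sum_p (\sum_i S i i p) * Gam p j k)
    + (\sum_p (\sum_i S i i p) * S p j k)
    - (\sum_i \sum_p Gam i k p * S p i j)
    - (\sum_i \sum_p S i k p * Gam p i j)
    - (\sum_i \sum_p S i k p * S p i j).
  under [X in _ + X + _ + _ - _ - _ - _]eq_bigr do rewrite mulr_suml.
  under [X in _ + _ + X + _ - _ - _ - _]eq_bigr do rewrite mulr_suml.
  under [X in _ + _ + _ + X - _ - _ - _]eq_bigr do rewrite mulr_suml.
  rewrite [X in _ + X + _ + _ - _ - _ - _]exchange_big /=.
  rewrite [X in _ + _ + X + _ - _ - _ - _]exchange_big /=.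
  rewrite [X in _ + _ + _ + X - _ - _ - _]exchange_big /=.
  rewrite -!big_split -!sumrB /=; apply: eq_bigr => i _.
  rewrite -!big_split -!sumrB /=; apply: eq_bigr => p _; ring.
rewrite cross_conf cross_conf' square_conf.
have -> : \sum_p (\sum_i Gam i i p) * S p j k =
    (\sum_i Gam i i k) * (om (c k) * be j) + (\sum_i Gam i i j) * (om (c j) * be k).
  rewrite contract_conf [X in _ - _ * X](_ : _ = 0) ?mulr0 ?subr0 //.
  by apply: big1 => p _; rewrite mulr_suml big1 // => i _; exact: GamB.
have -> : \sum_p (\sum_i S i i p) * Gam p j k = 0.
  by apply: big1 => p _; rewrite trace_conf -mulrA beGam mulr0.
have -> : \sum_p (\sum_i S i i p) * S p j k = Om *
    (be k * om (c k) * be j + be j * om (c j) * be k - ta (c j) * H j k * eps).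
  transitivity (Om * \sum_p be p * S p j k).
    by rewrite mulr_sumr; apply: eq_bigr => p _; rewrite trace_conf mulrA.
  by rewrite contract_conf /eps; ring.
rewrite !be_class [H k j]Hsym.
have -> : 2 * eps * (ta (c k) * om (c k)) * H j k =
    2 * eps * (ta (c j) * om (c j)) * H j k.
  by have [->//|/Hblock->] := eqVneq (c j) (c k); rewrite !mulr0.
ring.
Qed.

End RicciAlgebra.

(** * Rescaling the blocks of a metric *)

Section ScaledMetric.
Variables (R : realType) (d : nat) (T : eqType) (c : 'I_d -> T) (t0 : T).
Variables (be B : 'I_d -> R) (O : set 'rV[R]_d) (I : set R).
Variables (H : 'rV[R]_d -> 'M[R]_d) (rho om : T -> R -> R).
Hypothesis oO : open O.
Hypothesis OI : forall x, O x -> I (xi be x).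
Hypothesis Hsym : forall x i j, O x -> H x i j = H x j i.
Hypothesis Hunit : forall x, O x -> H x \in unitmx.
Hypothesis Hsmooth : forall i j, smooth_on O (fun x => H x i j).
Hypothesis Hblock : forall x i j, O x -> c i != c j -> H x i j = 0.
Hypothesis dHblock : forall x a i j, O x -> c a != c i \/ c i = t0 ->
  partial a (fun y => H y i j) x = 0.
Hypothesis be0 : forall i, c i != t0 -> be i = 0.
Hypothesis B0 : forall i, c i != t0 -> B i = 0.
Hypothesis BH : forall x p, O x -> \sum_i B i * H x i p = be p.
Hypothesis rho0 : forall t s, I s -> rho t s != 0.
Hypothesis rhoD : forall t s, I s ->
  is_derive s (1 : R) (rho t) (2 * rho t s * om t s).
Hypothesis omD : forall t s, I s -> derivable (om t) s 1.

(** The factor refers to the row only; the matrix is still symmetric on [O], because [H] vanishes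
    between different blocks. *)
Definition scaled_metric x := \matrix_(i, j) (rho (c i) (xi be x) * H x i j).

Local Notation G := scaled_metric.
Local Notation dH x a i j := (partial a (fun y => H y i j) x).

Lemma dHoff x a i j : O x -> c i != c j -> dH x a i j = 0.
Proof.
move=> Ox cij; have := eq_on_partial a oO (fun y Oy => Hblock Oy cij) Ox.
by rewrite partial_cst.
Qed.

Lemma dHsym x a i j : O x -> dH x a i j = dH x a j i.
Proof. by move=> Ox; apply: (eq_on_partial a oO) Ox => y Oy; exact: Hsym. Qed.

Lemma derivable_H x a i j : O x ->
  derivable (fun y => H y i j) x (delta_mx 0 a : 'rV[R]_d).
Proof. by move=> Ox; case: (smooth_onW (Hsmooth i j) Ox). Qed.

(** The projector [D] onto the block of [j] commutes with a block diagonal matrix, hence with its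
    inverse; the entry [(i, j)] of that commutation is the claim. *)
Lemma invH_block x i j : O x -> c i != c j -> invmx (H x) i j = 0.
Proof.
move=> Ox cij; set D : 'M[R]_d := diag_mx (\row_l (c l == c j)%:R).
have DH : D *m H x = H x *m D.
  apply/matrixP => a b; rewrite mul_diag_mx mul_mx_diag !mxE.
  have [<-|/(Hblock Ox)->] := eqVneq (c a) (c b); last by rewrite mulr0 mul0r.
  by rewrite mulrC.
have uH := Hunit Ox.
have DI : D *m invmx (H x) = invmx (H x) *m D.
  by rewrite -[LHS](mulKmx uH) [H x *m _]mulmxA -DH -[D *m _ *m _]mulmxA mulmxV // mulmx1.
have := congr1 (fun M : 'M[R]_d => M i j) DI.
by rewrite mul_diag_mx mul_mx_diag !mxE (negPf cij) eqxx mul0r mulr1 => <-.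
Qed.

Lemma christoffel_block x k i j : O x -> c k != c i -> christoffel H k i j x = 0.
Proof.
move=> Ox cki; rewrite /christoffel big1 ?mulr0 // => l _.
have [ckl|/(invH_block Ox)->] := eqVneq (c k) (c l); last by rewrite mul0r.
rewrite ckl in cki.
have -> : dH x i j l = 0.
  have [cjl|/(dHoff _ Ox)//] := eqVneq (c j) (c l).
  by apply: dHblock => //; left; rewrite cjl eq_sym.
rewrite (dHoff _ Ox) 1?eq_sym // (dHblock _ Ox); last by left.
by rewrite addr0 subr0 mulr0.
Qed.

(** The inverse keeps [l] in the block of [k], that is in [t0]. Entries of [H] with an index there
    are constant, and the other entries do not vary in the direction [l]. *)
Lemma christoffel_flat x k i j : O x -> c k = t0 -> christoffel H k i j x = 0.
Proof.
move=> Ox ck; rewrite /christoffel big1 ?mulr0 // => l _.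
have [ckl|/(invH_block Ox)->] := eqVneq (c k) (c l); last by rewrite mul0r.
have cl : c l = t0 by rewrite -ckl.
have E a b : dH x a b l = 0.
  have [cbl|/(dHoff _ Ox)//] := eqVneq (c b) (c l).
  by apply: dHblock => //; right; rewrite cbl.
have -> : dH x l i j = 0.
  have [ci|ci] := eqVneq (c i) t0; first by apply: dHblock => //; right.
  by apply: dHblock => //; left; rewrite cl eq_sym.
by rewrite !E addr0 subr0 mulr0.
Qed.

Lemma christoffel_sym x k i j : O x ->
  christoffel H k i j x = christoffel H k j i x.
Proof.
move=> Ox; rewrite /christoffel; congr (_ * _); apply: eq_bigr => l _.
by rewrite [dH x i j l + _]addrC [dH x l i j](dHsym _ _ _ Ox).
Qed.

Lemma invmx_scaled x k l : O x ->
  invmx (G x) k l = invmx (H x) k l / rho (c l) (xi be x).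
Proof.
move=> Ox; have Is := OI Ox; have uH := Hunit Ox.
set K := invmx (H x) *m diag_mx (\row_i (rho (c i) (xi be x))^-1).
have GE : G x = diag_mx (\row_i rho (c i) (xi be x)) *m H x.
  by apply/matrixP => a b; rewrite mul_diag_mx !mxE.
have GK : G x *m K = 1%:M.
  rewrite GE /K mulmxA mulmxK //; apply/matrixP => a b.
  rewrite mul_diag_mx !mxE mulrnAr; have [->|//] := eqVneq a b.
  by rewrite mulfV ?rho0.
have uG : G x \in unitmx by case: (mulmx1_unit GK).
have -> : invmx (G x) = K by rewrite -[RHS](mulKmx uG) GK mulmx1.
by rewrite /K mul_mx_diag !mxE.
Qed.

Lemma derivable_rho x t a : O x ->
  derivable (rho t \o xi be) x (delta_mx 0 a : 'rV[R]_d).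
Proof.
by move=> Ox; apply: derivable_xi; have dr := rhoD t (OI Ox); exact: ex_derive.
Qed.

Lemma partial_scaled x a i j : O x -> partial a (fun y => G y i j) x =
  2 * rho (c i) (xi be x) * om (c i) (xi be x) * be a * H x i j
  + rho (c i) (xi be x) * dH x a i j.
Proof.
move=> Ox.
have -> : (fun y => G y i j) = (fun y => (rho (c i) \o xi be) y * H y i j).
  by apply/funext => y; rewrite mxE.
rewrite (partialM (@derivable_rho x _ a Ox) (@derivable_H x a i j Ox)).
have dr := rhoD (c i) (OI Ox).
rewrite partial_xi; last exact: ex_derive.
by rewrite derive1E (derive_val (f := rho (c i))) /=; ring.
Qed.

(** The function [ta] of the algebraic part. The division by [rho t0] arises because [B] is [be]
    raised with [H], while the Christoffel symbols raise with the rescaled metric. *)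
Definition ratio_om t s := rho t s / rho t0 s * om t s.

Lemma christoffel_scaled x k i j : O x -> christoffel G k i j x =
  christoffel H k i j x
  + conf_tensor c (H x) be B (om^~ (xi be x)) (ratio_om^~ (xi be x)) k i j.
Proof.
move=> Ox; set s := xi be x; have Is : I s := OI Ox.
rewrite /christoffel /conf_tensor.
have uH := Hunit Ox.
have HV a b : \sum_l invmx (H x) a l * H x l b = (a == b)%:R.
  by have /matrixP/(_ a b) := mulVmx uH; rewrite !mxE.
have HB a : \sum_l invmx (H x) a l * be l = B a.
  have bE : \col_l be l = H x *m (\col_l B l).
    apply/matrixP => l z; rewrite !mxE -(BH l Ox); apply: eq_bigr => i' _.
    by rewrite mxE mulrC Hsym.
  have := mulKmx uH (\col_l B l); rewrite -bE => /matrixP/(_ a 0).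
  by rewrite !mxE => <-; apply: eq_bigr => l _; rewrite mxE.
(* The deltas and [B] are written back as contractions with [invmx (H x)], so that both sides become
   sums over [l] that agree term by term. *)
rewrite -(HV k j) -(HV k i) -(HB k).
rewrite mulr_sumr mulr_suml mulr_suml [in X in _ - X]mulr_sumr.
rewrite mulr_sumr -!big_split /= -sumrB -big_split /=; apply: eq_bigr => l _.
rewrite !(partial_scaled _ _ _ Ox) invmx_scaled // -/s /ratio_om.
have rr a b X : (c a != c b -> X = 0) ->
    rho (c a) s / rho (c b) s * X = X.
  have [->|_ -> //] := eqVneq (c a) (c b); last by rewrite mulr0.
  by rewrite mulfV ?mul1r ?rho0.
have r1 := rr j l (H x j l) (Hblock Ox).
have r2 := rr i l (H x i l) (Hblock Ox).
have r3 := rr j l (dH x i j l) (dHoff i Ox).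
have r4 := rr i l (dH x j i l) (dHoff j Ox).
have r5 : rho (c i) s / rho (c l) s * dH x l i j = dH x l i j.
  by apply: rr => cil; apply: dHblock => //; left; rewrite eq_sym.
have r6 := be_class be0 (fun t => (rho t s)^-1) l.
rewrite (Hsym l j Ox) (Hsym l i Ox).
set e := invmx (H x) k l.
transitivity (2^-1 * (e * (rho (c j) s / rho (c l) s * dH x i j l
    + rho (c i) s / rho (c l) s * dH x j i l
    - rho (c i) s / rho (c l) s * dH x l i j))
  + (2^-1 * 2) * e * (om (c j) s * be i * (rho (c j) s / rho (c l) s * H x j l)
    + om (c i) s * be j * (rho (c i) s / rho (c l) s * H x i l)
    - rho (c i) s * om (c i) s * H x i j * (be l / rho (c l) s))).
  ring.
rewrite r1 r2 r3 r4 r5 r6 mulVf ?pnatr_eq0 //; ring.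
Qed.

Lemma is_derive_ratio t s : I s -> is_derive s (1 : R) (ratio_om t)
  (rho t s / rho t0 s *
   (derive1 (om t) s + 2 * om t s ^+ 2 - 2 * om t s * om t0 s)).
Proof.
move=> Is; have d1 := rhoD t Is; have d2 := rhoD t0 Is.
have d3 := derivableP (@omD t _ Is).
have n0 := rho0 t0 Is.
have d4 := is_deriveV n0 d2.
have h := is_deriveM (is_deriveM d1 d4) d3.
have h' : is_derive s (1 : R) (ratio_om t) _ := h.
apply: (is_derive_eq h'); rewrite /GRing.scale /= derive1E.
by rewrite -[(rho t * _) s]/(rho t s * (rho t0 s)^-1); field.
Qed.

Lemma partial_christoffel_scaled x a k i j : O x ->
  partial a (christoffel G k i j) x = partial a (christoffel H k i j) x
  + dconf_tensor c (H x) (fun a i j => dH x a i j) be B (fun t => derive1 (om t) (xi be x))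
      (ratio_om^~ (xi be x)) (fun t => derive1 (ratio_om t) (xi be x)) a k i j.
Proof.
move=> Ox; have Is := OI Ox.
have sC := smooth_on_christoffel oO Hunit Hsmooth.
have h5 := derivableP ((smooth_onW (sC k i j) Ox).2 a).
have h1 := is_derive_xi a (@omD (c j) _ Is).
have h2 := is_derive_xi a (@omD (c i) _ Is).
have dr := is_derive_ratio (c i) Is.
have h3 := is_derive_xi a (@ex_derive _ _ _ _ _ _ _ dr).
have h4 := derivableP (@derivable_H x a i j Ox).
have h := is_deriveD h5 (is_deriveB (is_deriveD
  (is_deriveZ ((k == j)%:R * be i) h1) (is_deriveZ ((k == i)%:R * be j) h2))
  (is_deriveZ (B k) (is_deriveM h3 h4))).
(* The decomposition of the symbols holds on the whole open set [O], so it can be differentiated at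
   [x]. *)
have hG := near_eq_is_derive (near_open oO Ox _) h.
have E := @derive_val _ _ _ _ _ _ _ (hG (christoffel G k i j) _).
rewrite {1}/partial E => [|y Oy].
  rewrite /dconf_tensor /GRing.scale /partial /=.
  ring.
rewrite christoffel_scaled // /conf_tensor.
transitivity (christoffel H k i j y
  + (((k == j)%:R * be i) * om (c j) (xi be y)
     + ((k == i)%:R * be j) * om (c i) (xi be y)
     - B k * (ratio_om (c i) (xi be y) * H y i j))); first by [].
ring.
Qed.

Theorem ricci_scaled x j k : O x ->
  let s := xi be x in
  let Om := \sum_i om (c i) s in
  ricci G x j k = ricci H x j k
  + be j * be k * (2 * derive1 (om t0) s - \sum_i derive1 (om (c i)) s
      + 2 * Om * om t0 s - 2 * om t0 s ^+ 2 - \sum_i om (c i) s ^+ 2)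
  - (\sum_p be p * B p) * H x j k * (rho (c j) s / rho t0 s)
    * (derive1 (om (c j)) s + om (c j) s * (Om - 2 * om t0 s)).
Proof.
move=> Ox s Om; have Is : I s := OI Ox.
have t00 : rho t0 s / rho t0 s = 1 by rewrite mulfV ?rho0.
have dta t : derive1 (ratio_om t) s = rho t s / rho t0 s *
   (derive1 (om t) s + 2 * om t s ^+ 2 - 2 * om t s * om t0 s).
  by have dr := is_derive_ratio t Is; rewrite derive1E (derive_val (f := ratio_om t)).
have -> : ricci G x j k = ricci_of
  (fun a k i j => partial a (christoffel H k i j) x
  + dconf_tensor c (H x) (fun a i j => dH x a i j) be B (fun t => derive1 (om t) s)
      (ratio_om^~ s) (fun t => derive1 (ratio_om t) s) a k i j)
  (fun k i j => christoffel H k i j x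
     + conf_tensor c (H x) be B (om^~ s) (ratio_om^~ s) k i j) j k.
  rewrite ricciE; apply: (congr2 (fun a b => ricci_of a b j k)).
    apply/funext => a; apply/funext => k'; apply/funext => i; apply/funext => j'.
    exact: partial_christoffel_scaled.
  apply/funext => k'; apply/funext => i; apply/funext => j'.
  exact: christoffel_scaled.
rewrite (ricciE H).
apply: etrans.
  apply: (@ricci_of_conf _ _ _ c t0 (H x) (fun a i j => dH x a i j)
    (fun k i j => christoffel H k i j x)
    (fun a k i j => partial a (christoffel H k i j) x) be B (om^~ s)
    (fun t => derive1 (om t) s) (ratio_om^~ s)
    (fun t => derive1 (ratio_om t) s)).
- by move=> i' j'; exact: Hsym.
- by move=> i' j'; exact: Hblock.
- move=> a i' j' [ca|ci]; apply: dHblock => //; last by right.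
  by have [ci|ci] := eqVneq (c i') t0; [right|left; rewrite ca eq_sym].
- by move=> *; exact: christoffel_sym.
- by move=> *; exact: christoffel_block.
- by move=> *; exact: christoffel_flat.
- exact: be0.
- exact: B0.
- by move=> p; exact: BH.
- by rewrite /ratio_om t00 mul1r.
- by rewrite dta t00; ring.
(* The derivative of [ratio_om] brings a term [2 om^2], which cancels against [- 2 ta om]; the
   remaining factor is [om' + om (Om - 2 om_0)]. *)
by cbv beta; rewrite dta /ratio_om -/Om; ring.
Qed.

End ScaledMetric.

(** * Product metrics *)

(** [L] sends the line in direction [u] to the line in direction [v], and both difference quotients
    coincide. The case [v = 0] covers the coordinates of the other factor of a product. *)
Lemma derive_affine (R : realType) (d d' : nat) (F : 'rV[R]_d' -> R)
    (L : 'rV[R]_d -> 'rV[R]_d') (u : 'rV[R]_d) (v : 'rV[R]_d') x :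
  (forall h y, L (h *: u + y) = h *: v + L y) ->
  'D_u (F \o L) x = 'D_v F (L x) /\
  (derivable F (L x) v -> derivable (F \o L) x u).
Proof.
move=> HL; split.
  rewrite /derive; set A := fun h => _; set B := fun h => _.
  suff -> : A = B by [].
  by apply/funext => h; rewrite /A /B /= HL.
move=> dF; apply/derivable1P; move/derivable1P: dF.
rewrite (_ : (fun h : R => (F \o L) (h *: u + x)) = (fun h => F (h *: v + L x)));
  first by [].
by apply/funext => h; rewrite /= HL.
Qed.

(** * Functions of the coordinates of one factor *)

Section Submatrices.
Variables (R : realType) (d1 d2 : nat).
Implicit Types (x : 'rV[R]_(d1 + d2)).

Lemma lsubmx_lshift i (h : R) x :
  lsubmx (h *: delta_mx 0 (lshift d2 i) + x) = h *: delta_mx 0 i + lsubmx x.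
Proof.
apply/matrixP => a b; rewrite !mxE.
by rewrite (inj_eq (@lshift_inj _ _)).
Qed.

Lemma lsubmx_rshift i (h : R) x :
  lsubmx (h *: delta_mx 0 (rshift d1 i) + x) = h *: 0 + lsubmx x.
Proof. by apply/matrixP => a b; rewrite !mxE eq_lrshift andbF. Qed.

Lemma rsubmx_rshift i (h : R) x :
  rsubmx (h *: delta_mx 0 (rshift d1 i) + x) = h *: delta_mx 0 i + rsubmx x.
Proof.
apply/matrixP => a b; rewrite !mxE.
by rewrite (inj_eq (@rshift_inj _ _)).
Qed.

Lemma rsubmx_lshift i (h : R) x :
  rsubmx (h *: delta_mx 0 (lshift d2 i) + x) = h *: 0 + rsubmx x.
Proof. by apply/matrixP => a b; rewrite !mxE eq_rlshift andbF. Qed.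

Lemma partial_lsubmx (F : 'rV[R]_d1 -> R) i x :
  partial (lshift d2 i) (fun y => F (lsubmx y)) x = partial i F (lsubmx x).
Proof. exact: (derive_affine F x (lsubmx_lshift i)).1. Qed.

Lemma partial_lsubmx0 (F : 'rV[R]_d1 -> R) i x :
  partial (rshift d1 i) (fun y => F (lsubmx y)) x = 0.
Proof.
have := (derive_affine F x (lsubmx_rshift i)).1.
by rewrite derive0.
Qed.

Lemma partial_rsubmx (F : 'rV[R]_d2 -> R) i x :
  partial (rshift d1 i) (fun y => F (rsubmx y)) x = partial i F (rsubmx x).
Proof. exact: (derive_affine F x (rsubmx_rshift i)).1. Qed.

Lemma partial_rsubmx0 (F : 'rV[R]_d2 -> R) i x :
  partial (lshift d2 i) (fun y => F (rsubmx y)) x = 0.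
Proof.
have := (derive_affine F x (rsubmx_lshift i)).1.
by rewrite derive0.
Qed.

Lemma smooth_on_lsubmx (O : set 'rV[R]_d1) (F : 'rV[R]_d1 -> R) :
  smooth_on O F -> smooth_on [set x | O (lsubmx x)] (fun x : 'rV[R]_(d1 + d2) => F (lsubmx x)).
Proof.
move=> sF; apply/smooth_onP => k.
have reg G : regular_on O G -> regular_on [set x | O (lsubmx x)]
    (fun x : 'rV[R]_(d1 + d2) => G (lsubmx x)).
  move=> rG x /rG [cG dG]; split=> [|i].
    by apply: (@continuous_comp _ _ _ (@lsubmx R 1 d1 d2) G); [exact: continuous_lsubmx|].
  case: (split_ordP i) => i' ->.
    exact: (derive_affine G x (lsubmx_lshift i')).2 (dG i').
  by apply: (derive_affine G x (lsubmx_rshift i')).2; exact: derivable0.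
elim: k F sF => [|k IH] F sF; have rF := reg _ (smooth_onW sF).
  by split; [exact: rF|].
split=> [|i]; first exact: rF.
case: (split_ordP i) => i' ->.
  rewrite (_ : partial _ _ = fun x => partial i' F (lsubmx x)); last first.
    by apply/funext => x; exact: partial_lsubmx.
  exact: (IH _ (smooth_on_partial i' sF)).
rewrite (_ : partial _ _ = fun=> 0); last first.
  by apply/funext => x; exact: partial_lsubmx0.
exact: (proj1 (smooth_onP _ _) (@smooth_on_cst _ _ _ 0) k).
Qed.

Lemma smooth_on_rsubmx (O : set 'rV[R]_d2) (F : 'rV[R]_d2 -> R) :
  smooth_on O F -> smooth_on [set x | O (rsubmx x)] (fun x : 'rV[R]_(d1 + d2) => F (rsubmx x)).
Proof.
move=> sF; apply/smooth_onP => k.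
have reg G : regular_on O G -> regular_on [set x | O (rsubmx x)]
    (fun x : 'rV[R]_(d1 + d2) => G (rsubmx x)).
  move=> rG x /rG [cG dG]; split=> [|i].
    by apply: (@continuous_comp _ _ _ (@rsubmx R 1 d1 d2) G); [exact: continuous_rsubmx|].
  case: (split_ordP i) => i' ->.
    by apply: (derive_affine G x (rsubmx_lshift i')).2; exact: derivable0.
  exact: (derive_affine G x (rsubmx_rshift i')).2 (dG i').
elim: k F sF => [|k IH] F sF; have rF := reg _ (smooth_onW sF).
  by split; [exact: rF|].
split=> [|i]; first exact: rF.
case: (split_ordP i) => i' ->.
  rewrite (_ : partial _ _ = fun=> 0); last first.
    by apply/funext => x; exact: partial_rsubmx0.
  exact: (proj1 (smooth_onP _ _) (@smooth_on_cst _ _ _ 0) k).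
rewrite (_ : partial _ _ = fun x => partial i' F (rsubmx x)); last first.
  by apply/funext => x; exact: partial_rsubmx.
exact: (IH _ (smooth_on_partial i' sF)).
Qed.

End Submatrices.

Section ProductMetric.
Variables (R : realType) (d1 d2 : nat).
Variables (O1 : set 'rV[R]_d1) (O2 : set 'rV[R]_d2).
Variables (A : 'rV[R]_d1 -> 'M[R]_d1) (B : 'rV[R]_d2 -> 'M[R]_d2).
Hypothesis oO1 : open O1.
Hypothesis oO2 : open O2.
Hypothesis uA : forall x, O1 x -> A x \in unitmx.
Hypothesis uB : forall x, O2 x -> B x \in unitmx.

Definition product_metric (x : 'rV[R]_(d1 + d2)) : 'M[R]_(d1 + d2) :=
  block_mx (A (lsubmx x)) 0 0 (B (rsubmx x)).

Definition product_dom : set 'rV[R]_(d1 + d2) :=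
  [set x | O1 (lsubmx x) /\ O2 (rsubmx x)].

Local Notation P := product_metric.
Local Notation O := product_dom.

Lemma open_product_dom : open O.
Proof.
have -> : O = (lsubmx @^-1` O1) `&` (rsubmx @^-1` O2) by [].
apply: openI.
  by apply: open_comp oO1 => x _; exact: continuous_lsubmx.
by apply: open_comp oO2 => x _; exact: continuous_rsubmx.
Qed.

(* [None] is never taken: it plays the role of the distinguished block required
   by [christoffel_block]. *)
Definition side (i : 'I_(d1 + d2)) : option bool := Some (i < d1)%N.

Lemma side_lshift i : side (lshift d2 i) = Some true.
Proof. by rewrite /side /= ltn_ord. Qed.

Lemma side_rshift i : side (rshift d1 i) = Some false.
Proof. by rewrite /side /= ltnNge leq_addr. Qed.

Let sideE := (side_lshift, side_rshift).

Lemma product_metric_ll i j :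
  (fun y => P y (lshift d2 i) (lshift d2 j)) = (fun y => A (lsubmx y) i j).
Proof. by apply/funext => y; rewrite /P block_mxEul. Qed.

Lemma product_metric_lr i j :
  (fun y => P y (lshift d2 i) (rshift d1 j)) = (fun=> 0).
Proof. by apply/funext => y; rewrite /P block_mxEur mxE. Qed.

Lemma product_metric_rl i j :
  (fun y => P y (rshift d1 i) (lshift d2 j)) = (fun=> 0).
Proof. by apply/funext => y; rewrite /P block_mxEdl mxE. Qed.

Lemma product_metric_rr i j :
  (fun y => P y (rshift d1 i) (rshift d1 j)) = (fun y => B (rsubmx y) i j).
Proof. by apply/funext => y; rewrite /P block_mxEdr. Qed.

Lemma product_metric_block x i j : side i != side j -> P x i j = 0.
Proof.
by case: (split_ordP i) => i' ->; case: (split_ordP j) => j' ->; rewrite !sideE //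
  /P ?block_mxEur ?block_mxEdl mxE.
Qed.

Lemma partial_product_metric x a i j : side a != side i \/ side i = None ->
  partial a (fun y => P y i j) x = 0.
Proof.
case=> //; case: (split_ordP i) => i' ->; case: (split_ordP j) => j' ->.
- case: (split_ordP a) => a' ->; rewrite !sideE ?eqxx // => _.
  by rewrite product_metric_ll (partial_lsubmx0 (fun y => A y i' j')).
- by rewrite product_metric_lr partial_cst.
- by rewrite product_metric_rl partial_cst.
- case: (split_ordP a) => a' ->; rewrite !sideE ?eqxx // => _.
  by rewrite product_metric_rr (partial_rsubmx0 (fun y => B y i' j')).
Qed.

Lemma invmx_product x : O x ->
  invmx (P x) = block_mx (invmx (A (lsubmx x))) 0 0 (invmx (B (rsubmx x))).
Proof.
move=> [x1 x2]; set K := block_mx _ _ _ _.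
have PK : P x *m K = 1%:M.
  rewrite /P /K mulmx_block !mul0mx !mulmx0 !addr0 !add0r.
  by rewrite !mulmxV ?uA ?uB // -scalar_mx_block.
have uP : P x \in unitmx by case: (mulmx1_unit PK).
by rewrite -[RHS](mulKmx uP) PK mulmx1.
Qed.

Lemma product_metric_unit x : O x -> P x \in unitmx.
Proof.
move=> [x1 x2]; rewrite unitmxE /P det_ublock unitrM -!unitmxE.
by rewrite uA ?uB.
Qed.

Lemma christoffel_lll x k i j : O x ->
  christoffel P (lshift d2 k) (lshift d2 i) (lshift d2 j) x =
  christoffel A k i j (lsubmx x).
Proof.
move=> Ox; rewrite /christoffel invmx_product // big_split_ord /=.
rewrite [X in _ * (_ + X)]big1 => [|l _]; last first.
  by rewrite block_mxEur mxE mul0r.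
rewrite addr0; congr (_ * _); apply: eq_bigr => l _.
rewrite block_mxEul !product_metric_ll.
have E a b e := partial_lsubmx (fun y => A y b e) a x.
by rewrite !E.
Qed.

Lemma christoffel_rrr x k i j : O x ->
  christoffel P (rshift d1 k) (rshift d1 i) (rshift d1 j) x =
  christoffel B k i j (rsubmx x).
Proof.
move=> Ox; rewrite /christoffel invmx_product // big_split_ord /=.
rewrite [X in _ * (X + _)]big1 => [|l _]; last first.
  by rewrite block_mxEdl mxE mul0r.
rewrite add0r; congr (_ * _); apply: eq_bigr => l _.
rewrite block_mxEdr !product_metric_rr.
have E a b e := partial_rsubmx (fun y => B y b e) a x.
by rewrite !E.
Qed.

Lemma christoffel_mixed1 x k i j : O x -> side k != side i ->
  christoffel P k i j x = 0.
Proof.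
apply: (christoffel_block (t0 := None) open_product_dom) => //.
- exact: product_metric_unit.
- by move=> y i' j' _; exact: product_metric_block.
- by move=> y a i' j' _; exact: partial_product_metric.
Qed.

Lemma christoffel_mixed2 x k i j : O x -> side k != side j ->
  christoffel P k i j x = 0.
Proof.
move=> Ox kj; rewrite /christoffel big1 ?mulr0 // => l _.
have [kl|kl] := eqVneq (side k) (side l); last first.
  have -> : invmx (P x) k l = 0.
    rewrite invmx_product //; move: kl.
    by case: (split_ordP k) => k' ->; case: (split_ordP l) => l' ->;
      rewrite !sideE // ?block_mxEur ?block_mxEdl mxE.
  by rewrite mul0r.
have -> : partial i (fun y => P y j l) x = 0.
  rewrite (_ : (fun y => _) = fun=> 0) ?partial_cst //; apply/funext => y.
  by rewrite product_metric_block // -kl eq_sym.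
have -> : partial j (fun y => P y i l) x = 0.
  have [il|il] := eqVneq (side i) (side l).
    by apply: partial_product_metric; left; rewrite il -kl eq_sym.
  rewrite (_ : (fun y => _) = fun=> 0) ?partial_cst //; apply/funext => y.
  by rewrite product_metric_block.
have -> : partial l (fun y => P y i j) x = 0.
  have [li|li] := eqVneq (side l) (side i); last first.
    by apply: partial_product_metric; left.
  rewrite (_ : (fun y => _) = fun=> 0) ?partial_cst //; apply/funext => y.
  by rewrite product_metric_block // -li -kl.
by rewrite addr0 subr0 mulr0.
Qed.

Lemma partial_christoffel_mixed x a k i j : O x ->
  side k != side i \/ side k != side j ->
  partial a (christoffel P k i j) x = 0.
Proof.
move=> Ox kij; have := eq_on_partial a open_product_dom
  (F := christoffel P k i j) (G := fun=> 0) _ Ox.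
rewrite partial_cst; apply=> y Oy.
by case: kij => ?; [exact: christoffel_mixed1|exact: christoffel_mixed2].
Qed.

Lemma partial_christoffel_l x a k i j : O x ->
  partial a (christoffel P (lshift d2 k) (lshift d2 i) (lshift d2 j)) x =
  partial a (fun y => christoffel A k i j (lsubmx y)) x.
Proof.
move=> Ox; apply: (eq_on_partial a open_product_dom) Ox => y Oy.
exact: christoffel_lll.
Qed.

Lemma partial_christoffel_r x a k i j : O x ->
  partial a (christoffel P (rshift d1 k) (rshift d1 i) (rshift d1 j)) x =
  partial a (fun y => christoffel B k i j (rsubmx y)) x.
Proof.
move=> Ox; apply: (eq_on_partial a open_product_dom) Ox => y Oy.
exact: christoffel_rrr.
Qed.

Lemma partial_christoffel_ll x a k i j : O x ->
  partial (lshift d2 a) (christoffel P (lshift d2 k) (lshift d2 i) (lshift d2 j)) x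
  = partial a (christoffel A k i j) (lsubmx x).
Proof.
by move=> Ox; rewrite partial_christoffel_l; [exact: partial_lsubmx|exact: Ox].
Qed.

Lemma partial_christoffel_lr x a k i j : O x ->
  partial (rshift d1 a) (christoffel P (lshift d2 k) (lshift d2 i) (lshift d2 j)) x
  = 0.
Proof.
by move=> Ox; rewrite partial_christoffel_l; [exact: partial_lsubmx0|exact: Ox].
Qed.

Lemma partial_christoffel_rr x a k i j : O x ->
  partial (rshift d1 a) (christoffel P (rshift d1 k) (rshift d1 i) (rshift d1 j)) x
  = partial a (christoffel B k i j) (rsubmx x).
Proof.
by move=> Ox; rewrite partial_christoffel_r; [exact: partial_rsubmx|exact: Ox].
Qed.

Lemma partial_christoffel_rl x a k i j : O x ->
  partial (lshift d2 a) (christoffel P (rshift d1 k) (rshift d1 i) (rshift d1 j)) x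
  = 0.
Proof.
by move=> Ox; rewrite partial_christoffel_r; [exact: partial_rsubmx0|exact: Ox].
Qed.

(** A Christoffel symbol survives only with all three indices on one side, and then depends only on
    the coordinates of that side. Hence diagonal blocks reduce to the factors, and in every other
    quadratic term each product has a mixed factor. *)
Lemma ricci_product x : O x ->
  ricci P x = block_mx (ricci A (lsubmx x)) 0 0 (ricci B (rsubmx x)).
Proof.
move=> Ox; apply/matrixP => j k.
have lr i j' : side (lshift d2 i) != side (rshift d1 j') by rewrite !sideE.
have rl i j' : side (rshift d1 i) != side (lshift d2 j') by rewrite !sideE.
have m1 := christoffel_mixed1 _ Ox; have m2 := christoffel_mixed2 _ Ox.
have pm1 a k' i j' (h : side k' != side i) :
  partial a (christoffel P k' i j') x = 0.
  by apply: partial_christoffel_mixed => //; left.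
have pm2 a k' i j' (h : side k' != side j') :
  partial a (christoffel P k' i j') x = 0.
  by apply: partial_christoffel_mixed => //; right.
have z (a b c d : R) : a = 0 \/ b = 0 -> c = 0 \/ d = 0 -> a * b - c * d = 0.
  by move=> [->|->] [->|->]; rewrite ?mul0r ?mulr0 subr0.
have z2 (a b : R) : a = 0 -> b = 0 -> a - b = 0 by move=> -> ->; rewrite subr0.
rewrite ricciE /ricci_of.
case: (split_ordP j) => j' ->; case: (split_ordP k) => k' ->.
- rewrite block_mxEul ricciE /ricci_of; congr (_ + _).
    rewrite big_split_ord /= [X in _ + X]big1 ?addr0 => [|i _].
      apply: eq_bigr => i _; apply: (congr2 (fun a b : R => a - b));
        exact: partial_christoffel_ll.
    by apply: z2; [apply: pm1|apply: pm2]; exact: rl.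
  rewrite big_split_ord /= [X in _ + X]big1 ?addr0 => [|i _].
    apply: eq_bigr => i _; rewrite big_split_ord /= [X in _ + X]big1 ?addr0.
      apply: eq_bigr => p _.
      by rewrite !(christoffel_lll _ _ _ Ox).
    by move=> p _; apply: z; left; [apply: m2|apply: m2]; exact: lr.
  apply: big1 => p _; case: (split_ordP p) => p' ->; apply: z.
  + by left; apply: m2; exact: rl.
  + by left; apply: m1; exact: rl.
  + by right; apply: m1; exact: rl.
  + by right; apply: m2; exact: rl.
- rewrite block_mxEur mxE big1 ?add0r => [|i _]; last first.
    case: (split_ordP i) => i' ->; apply: z2.
    + by apply: pm2; exact: lr.
    (* The only unmixed symbol in this block: it depends on left coordinates but is differentiated
       along a right one. *)
    + exact: partial_christoffel_lr.
    + by apply: pm1; exact: rl.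
    + by apply: pm2; exact: rl.
  apply: big1 => i _; apply: big1 => p _.
  case: (split_ordP i) => i' ->; case: (split_ordP p) => p' ->; apply: z.
  + by right; apply: m2; exact: lr.
  + by left; apply: m1; exact: lr.
  + by left; apply: m2; exact: lr.
  + by left; apply: m1; exact: lr.
  + by left; apply: m2; exact: rl.
  + by left; apply: m2; exact: rl.
  + by right; apply: m1; exact: rl.
  + by right; apply: m2; exact: rl.
- rewrite block_mxEdl mxE big1 ?add0r => [|i _]; last first.
    case: (split_ordP i) => i' ->; apply: z2.
    + by apply: pm1; exact: lr.
    + by apply: pm2; exact: lr.
    + by apply: pm2; exact: rl.
    + exact: partial_christoffel_rl.
  apply: big1 => i _; apply: big1 => p _.
  case: (split_ordP i) => i' ->; case: (split_ordP p) => p' ->; apply: z.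
  + by right; apply: m1; exact: lr.
  + by right; apply: m2; exact: lr.
  + by left; apply: m2; exact: lr.
  + by left; apply: m2; exact: lr.
  + by left; apply: m2; exact: rl.
  + by left; apply: m1; exact: rl.
  + by right; apply: m2; exact: rl.
  + by left; apply: m1; exact: rl.
- rewrite block_mxEdr ricciE /ricci_of; congr (_ + _).
    rewrite big_split_ord /= [X in X + _]big1 ?add0r => [|i _].
      apply: eq_bigr => i _; apply: (congr2 (fun a b : R => a - b));
        exact: partial_christoffel_rr.
    by apply: z2; [apply: pm1|apply: pm2]; exact: lr.
  rewrite big_split_ord /= [X in X + _]big1 ?add0r => [|i _].
    apply: eq_bigr => i _; rewrite big_split_ord /= [X in X + _]big1 ?add0r.
      apply: eq_bigr => p _.
      by rewrite !(christoffel_rrr _ _ _ Ox).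
    by move=> p _; apply: z; left; [apply: m2|apply: m2]; exact: rl.
  apply: big1 => p _; case: (split_ordP p) => p' ->; apply: z.
  + by right; apply: m1; exact: lr.
  + by left; apply: m1; exact: lr.
  + by left; apply: m2; exact: lr.
  + by left; apply: m1; exact: lr.
Qed.

End ProductMetric.

(** * Warped products are semi-Riemannian manifolds *)

Lemma hausdorff_prod (T U : topologicalType) :
  hausdorff_space T -> hausdorff_space U -> hausdorff_space (T * U)%type.
Proof.
move=> hT hU [p1 p2] [q1 q2] pq; congr (_, _).
  apply: hT => A B pA qB.
  have [||[x y] [Ax Bx]] := pq (A `*` setT) (B `*` setT).
  - by exists (A, setT) => //; split=> //; exact: filterT.
  - by exists (B, setT) => //; split=> //; exact: filterT.
  by exists x; split; [case: Ax|case: Bx].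
apply: hU => A B pA qB.
have [||[x y] [Ax Bx]] := pq (setT `*` A) (setT `*` B).
- by exists (setT, A) => //; split=> //; exact: filterT.
- by exists (setT, B) => //; split=> //; exact: filterT.
by exists y; split; [case: Ax|case: Bx].
Qed.

Lemma set_val_continuous (T : topologicalType) (A : set T) :
  continuous (set_val : set_type A -> T).
Proof. exact: initial_continuous. Qed.

Lemma hausdorff_set_type (T : topologicalType) (A : set T) :
  hausdorff_space T -> hausdorff_space (set_type A).
Proof.
move=> hT p q pq; apply: val_inj; apply: hT => B C pB qC.
have [x [Bx Cx]] := pq (set_val @^-1` B) (set_val @^-1` C)
  (set_val_continuous pB) (set_val_continuous qC).
by exists (set_val x).
Qed.

Lemma second_countable_prod (T U : topologicalType) :
  @second_countable T -> @second_countable U -> @second_countable (T * U)%type.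
Proof.
move=> [A cA [oA bA]] [B cB [oB bB]].
exists [set C | exists2 X, (A `*` B) X & X.1 `*` X.2 = C].
  have -> : [set C | exists2 X, (A `*` B) X & X.1 `*` X.2 = C] =
      (fun X : set T * set U => X.1 `*` X.2) @` (A `*` B) by [].
  by apply: sub_countable (countableX cA cB); exact: card_image_le.
split.
  move=> _ [[X Y] /= [AX BY] <-]; rewrite openE => -[x y] /= [Xx Yy].
  exists (X, Y) => //=; split; first exact: open_nbhs_nbhs (conj (oA _ AX) Xx).
  exact: open_nbhs_nbhs (conj (oB _ BY) Yy).
move=> [x y] W [[X Y] /= [xX yY] XYW].
have [X' [AX' X'x] X'X] := bA x X xX; have [Y' [BY' Y'y] Y'Y] := bB y Y yY.
exists (X' `*` Y'); first by split=> //; exists (X', Y').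
by move=> [u v] [/= /X'X Xu /Y'Y Yv]; exact: XYW.
Qed.

Lemma second_countable_set_type (T : topologicalType) (A : set T) :
  @second_countable T -> @second_countable (set_type A).
Proof.
move=> [B cB [oB bB]].
exists ((fun X : set T => (set_val : set_type A -> T) @^-1` X) @` B).
  by apply: sub_countable cB; exact: card_image_le.
split; first by move=> _ [X BX <-]; exists X => //; exact: oB.
move=> x W [_ [[Y oY <-] Yx] YW].
have [X [BX Xx] XY] := bB (set_val x) Y (open_nbhs_nbhs (conj oY Yx)).
exists (set_val @^-1` X); first by split=> //; exists X.
by move=> z Xz; apply: YW; exact: XY.
Qed.

(** The boxes with rational end points form a countable base; they are indexed by pairs of finite
    functions into [rat]. *)
Lemma second_countable_rV (R : realType) n : @second_countable 'rV[R]_n.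
Proof.
pose box (lh : {ffun 'I_n -> rat} * {ffun 'I_n -> rat}) : set 'rV[R]_n :=
  [set x | forall j, ratr (lh.1 j) < x 0 j < ratr (lh.2 j)].
exists (range box).
  apply: sub_countable (countableP [set: {ffun 'I_n -> rat} * {ffun 'I_n -> rat}]).
  exact: card_image_le.
split.
  move=> _ [lh _ <-]; rewrite openE => x /= lx.
  exists (fun _ j => [set t : R | ratr (lh.1 j) < t < ratr (lh.2 j)]).
    move=> i j; rewrite (ord1 i); have /andP[l1 l2] := lx j.
    have -> : [set t : R | ratr (lh.1 j) < t < ratr (lh.2 j)] =
      `](ratr (lh.1 j) : R), (ratr (lh.2 j) : R)[%classic.
      by apply/seteqP; split=> t /=; rewrite in_itv.
    by apply: open_nbhs_nbhs; split; [exact: interval_open|rewrite /= in_itv /= lx].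
  by move=> y /= yl j; exact: (yl 0 j).
move=> x W /nbhs_ballP[e /= e0 eW].
have lo j : exists q : rat, x 0 j - e < ratr q < x 0 j.
  have /rat_in_itvoo[q] : x 0 j - e < x 0 j by rewrite ltrBlDr ltrDl.
  by rewrite in_itv /=; exists q.
have hi j : exists q : rat, x 0 j < ratr q < x 0 j + e.
  have /rat_in_itvoo[q] : x 0 j < x 0 j + e by rewrite ltrDl.
  by rewrite in_itv /=; exists q.
have [l lP] := choice lo; have [h hP] := choice hi.
exists (box ([ffun j => l j], [ffun j => h j])).
  split; first by exists ([ffun j => l j], [ffun j => h j]).
  move=> j; rewrite !ffunE; have /andP[_ ->] := lP j.
  by have /andP[-> _] := hP j.
move=> y yb; apply: eW; split=> // i j; rewrite (ord1 i) /ball /=.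
have /andP[y1 y2] := yb j; rewrite !ffunE in y1 y2.
have /andP[l1 l2] := lP j; have /andP[h1 h2] := hP j.
rewrite ltr_norml; apply/andP; split; lra.
Qed.

(** * Values in charts *)

Section Charts.
Variables (R : realType) (d : nat) (M : metric_atlas R d).
Hypothesis hM : is_manifold M.
Implicit Types (a b : chart M) (p : M).

Definition chart_image a := chart_map a @` chart_dom a.

Definition overlap a b := chart_map a @` (chart_dom a `&` chart_dom b).

(** [xget] chooses some value over the given coordinates; injectivity of the chart leaves just
    one. *)
Lemma in_chartE (V : choiceType) (v0 : V) a (F : M -> V) p :
  chart_dom a p -> in_chart v0 a F (chart_map a p) = F p.
Proof.
move=> ap; case: hM => _ _ _ /(_ a)[_ inj _ _] _.
apply: xget_unique; first by exists p.
by move=> _ [q [/= aq qp] <-]; congr F; apply: inj; rewrite ?inE.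
Qed.

Lemma open_chart_dom a : open (chart_dom a).
Proof. by case: hM => _ _ _ /(_ a)[]. Qed.

Lemma open_chart_map a (O : set M) : open O -> O `<=` chart_dom a ->
  open (chart_map a @` O).
Proof. by move=> oO Oa; case: hM => _ _ _ /(_ a)[_ _ _ im] _; exact: im. Qed.

Lemma open_chart_image a : open (chart_image a).
Proof. exact: (open_chart_map (open_chart_dom a)). Qed.

Lemma transitionE a b p : chart_dom a p ->
  transition a b (chart_map a p) = chart_map b p.
Proof. exact: in_chartE. Qed.

End Charts.

Section WarpedProduct.
Variables (R : realType) (d1 d2 : nat).
Variables (M1 : metric_atlas R d1) (M2 : metric_atlas R d2) (f : M1 -> R).
Hypothesis hM1 : is_manifold M1.
Hypothesis hM2 : is_manifold M2.

Local Notation W := (warped_product f M2).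
Implicit Types (a b : chart W) (p : W).

Lemma warped_chart a : is_chart a.
Proof.
case: a => a1 a2.
have [dom1 inj1 c1 im1] : is_chart a1 by case: hM1.
have [dom2 inj2 c2 im2] : is_chart a2 by case: hM2.
have oa : open (@chart_dom _ _ W (a1, a2)).
  rewrite openE => -[p q] /= [ap aq].
  exists (chart_dom a1, chart_dom a2) => //=.
  by split; apply: open_nbhs_nbhs.
split=> //.
- move=> [p1 p2] [q1 q2]; rewrite !inE /= => -[/= ap1 ap2] [/= aq1 aq2].
  by case/eq_row_mx => e1 e2; congr (_, _); [apply: inj1|apply: inj2]; rewrite ?inE.
- rewrite continuous_open_subspace // => -[p1 p2]; rewrite inE => -[/= ap1 ap2].
  rewrite continuous_open_subspace // in c1; rewrite continuous_open_subspace // in c2.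
  have k1 := c1 p1 (mem_set ap1); have k2 := c2 p2 (mem_set ap2).
  move=> A [P nP PA].
  have nl : nbhs p1 [set u | forall j, P 0 (lshift d2 j) (chart_map a1 u 0 j)].
    apply: (k1 [set y | forall j, P 0 (lshift d2 j) (y 0 j)]); exists (fun _ j => P 0 (lshift d2 j));
      last by move=> y yP j; exact: (yP 0).
    by move=> i j; rewrite (ord1 i); have := nP 0 (lshift d2 j); rewrite /= row_mxEl.
  have nr : nbhs p2 [set u | forall j, P 0 (rshift d1 j) (chart_map a2 u 0 j)].
    apply: (k2 [set y | forall j, P 0 (rshift d1 j) (y 0 j)]); exists (fun _ j => P 0 (rshift d1 j));
      last by move=> y yP j; exact: (yP 0).
    by move=> i j; rewrite (ord1 i); have := nP 0 (rshift d1 j); rewrite /= row_mxEr.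
  exists ([set u | forall j, P 0 (lshift d2 j) (chart_map a1 u 0 j)],
    [set u | forall j, P 0 (rshift d1 j) (chart_map a2 u 0 j)]).
    by split; [exact: nl|exact: nr].
  move=> [u v] [/= ul vr]; apply: PA => i j; rewrite (ord1 i).
  by case: (split_ordP j) => j' ->; rewrite ?row_mxEl ?row_mxEr.
- move=> O oO OW; rewrite openE => _ [[p1 p2] Op <-].
  move: (oO); rewrite openE => /(_ _ Op)[[A B] /= [pA pB] ABO].
  (* [im1] and [im2] need open sets, while [A] and [B] are only neighbourhoods. A point of [U1]
     paired with [p2] lies in [O], hence [U1] lies in the chart domain; likewise for [U2] with
     [p1]. *)
  pose U1 := A°; pose U2 := B°.
  have U1p : U1 p1 by exact: pA.
  have U2p : U2 p2 by exact: pB.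
  have UO x y : U1 x -> U2 y -> O (x, y).
    by move=> /interior_subset Ax /interior_subset By; exact: ABO.
  have s1 : U1 `<=` chart_dom a1 by move=> x /UO/(_ U2p)/OW[].
  have s2 : U2 `<=` chart_dom a2 by move=> y /(UO _ _ U1p)/OW[].
  have oP := open_product_dom (im1 _ (open_interior A) s1) (im2 _ (open_interior B) s2).
  have : nbhs (row_mx (chart_map a1 p1) (chart_map a2 p2))
      (product_dom (chart_map a1 @` U1) (chart_map a2 @` U2)).
    apply: open_nbhs_nbhs; split=> //; split; rewrite ?row_mxKl ?row_mxKr.
      by exists p1.
    by exists p2.
  apply: filterS => x [[u U1u ux] [v U2v vx]].
  by exists (u, v); [exact: UO|rewrite /= ux vx hsubmxK].
Qed.

Lemma warped_overlap a b x : overlap a b x ->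
  overlap a.1 b.1 (lsubmx x) /\ overlap a.2 b.2 (rsubmx x).
Proof.
move=> [[p1 p2] [[/= ap1 ap2] [/= bp1 bp2]] <-].
by rewrite row_mxKl row_mxKr; split; [exists p1|exists p2].
Qed.

(** The analogue of [in_chartE], derived from injectivity of the product chart alone, so that it can
    serve in proving that [W] is a manifold. *)
Lemma warped_in_chart (V : choiceType) (v0 : V) a (F : W -> V) p :
  chart_dom a p -> in_chart v0 a F (chart_map a p) = F p.
Proof.
move=> ap; have [_ inj _ _] := warped_chart a.
apply: xget_unique; first by exists p.
by move=> _ [q [/= aq qp] <-]; congr F; apply: inj; rewrite ?inE.
Qed.

Lemma warped_open_overlap a b : open (overlap a b).
Proof.
have [oa _ _ im] := warped_chart a; have [ob _ _ _] := warped_chart b.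
by apply: im => [|p []//]; exact: openI.
Qed.

Lemma warped_transition a b x : overlap a b x ->
  transition a b x = row_mx (transition a.1 b.1 (lsubmx x))
                            (transition a.2 b.2 (rsubmx x)).
Proof.
move=> [[p1 p2] [ap bp] <-]; rewrite {1}/transition (warped_in_chart _ _ ap) /=.
case: ap => /= ap1 ap2.
by rewrite row_mxKl row_mxKr (transitionE hM1 _ ap1) (transitionE hM2 _ ap2).
Qed.

Lemma warped_manifold : is_manifold W.
Proof.
have [h1 s1 cov1 _ tr1] := hM1; have [h2 s2 cov2 _ tr2] := hM2.
split.
- exact: hausdorff_prod.
- exact: second_countable_prod.
- move=> [p1 p2]; have [a1 ap1] := cov1 p1; have [a2 ap2] := cov2 p2.
  by exists (a1, a2).
- exact: warped_chart.
- move=> a b j; have oS := @warped_open_overlap a b.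
  case: (split_ordP j) => j' ->.
  + have sT := smooth_on_lsubmx (d2 := d2) (tr1 a.1 b.1 j').
    apply: (eq_on_smooth oS _ (smooth_on_subset _ sT)) => [x Sx|x /warped_overlap[]//].
    by rewrite warped_transition // row_mxEl.
  + have sT := smooth_on_rsubmx (d1 := d1) (tr2 a.2 b.2 j').
    apply: (eq_on_smooth oS _ (smooth_on_subset _ sT)) => [x Sx|x /warped_overlap[]//].
    by rewrite warped_transition // row_mxEr.
Qed.

Lemma warped_jacobian a b x : overlap a b x ->
  jacobian_matrix (transition a b) x =
  block_mx (jacobian_matrix (transition a.1 b.1) (lsubmx x)) 0
           0 (jacobian_matrix (transition a.2 b.2) (rsubmx x)).
Proof.
move=> Sx; have oS := @warped_open_overlap a b.
have E (G : 'rV[R]_(d1 + d2) -> R) i j :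
    (forall y, overlap a b y -> transition a b y 0 j = G y) ->
    partial i (fun y => transition a b y 0 j) x = partial i G x.
  by move=> /(eq_on_partial i oS); exact.
apply/matrixP => i j.
have El j' y : overlap a b y ->
    transition a b y 0 (lshift d2 j') = transition a.1 b.1 (lsubmx y) 0 j'.
  by move=> /warped_transition->; rewrite row_mxEl.
have Er j' y : overlap a b y ->
    transition a b y 0 (rshift d1 j') = transition a.2 b.2 (rsubmx y) 0 j'.
  by move=> /warped_transition->; rewrite row_mxEr.
case: (split_ordP i) => i' ->; case: (split_ordP j) => j' ->.
- rewrite block_mxEul !mxE (E _ _ _ (El j')).
  exact: (partial_lsubmx (fun y => transition a.1 b.1 y 0 j')).
- rewrite block_mxEur !mxE (E _ _ _ (Er j')).
  exact: (partial_rsubmx0 (fun y => transition a.2 b.2 y 0 j')).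
- rewrite block_mxEdl !mxE (E _ _ _ (El j')).
  exact: (partial_lsubmx0 (fun y => transition a.1 b.1 y 0 j')).
- rewrite block_mxEdr !mxE (E _ _ _ (Er j')).
  exact: (partial_rsubmx (fun y => transition a.2 b.2 y 0 j')).
Qed.

Hypothesis gM1 : is_metric M1.
Hypothesis gM2 : is_metric M2.
Hypothesis f0 : forall u, f u != 0.
Hypothesis fS : forall a1 : chart M1, smooth_on (chart_image a1) (in_chart 0 a1 f).

Lemma warped_in_chart_l (V : choiceType) (v0 : V) a (F : M1 -> V) x :
  chart_image a x ->
  in_chart v0 a (fun p => F p.1) x = in_chart v0 a.1 F (lsubmx x).
Proof.
move=> [[p1 p2] ap <-]; rewrite (warped_in_chart _ _ ap) /=.
by case: ap => /= ap1 ap2; rewrite row_mxKl (in_chartE hM1 _ _ ap1).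
Qed.

Lemma warped_in_chart_r (V : choiceType) (v0 : V) a (F : M2 -> V) x :
  chart_image a x ->
  in_chart v0 a (fun p => F p.2) x = in_chart v0 a.2 F (rsubmx x).
Proof.
move=> [[p1 p2] ap <-]; rewrite (warped_in_chart _ _ ap) /=.
by case: ap => /= ap1 ap2; rewrite row_mxKr (in_chartE hM2 _ _ ap2).
Qed.

Lemma warped_image a x : chart_image a x ->
  chart_image a.1 (lsubmx x) /\ chart_image a.2 (rsubmx x).
Proof.
move=> [[p1 p2] [/= ap1 ap2] <-].
by rewrite row_mxKl row_mxKr; split; [exists p1|exists p2].
Qed.

Lemma warped_metric : is_metric W.
Proof.
have [su1 sm1 tr1 [s1 ind1]] := gM1; have [su2 sm2 tr2 [s2 ind2]] := gM2.
split.
- move=> a [p1 p2] [/= ap1 ap2].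
  have [g1 u1] := su1 _ _ ap1; have [g2 u2] := su2 _ _ ap2; split.
    by rewrite tr_block_mx !trmx0 g1 linearZ /= g2.
  rewrite unitmxE det_ublock unitrM -!unitmxE u1 /= unitmxZ //.
  by rewrite unitfE expf_neq0.
- move=> a i j; have oS := @open_chart_image _ _ _ warped_manifold a.
  have sl := @smooth_on_subset _ _ _ (chart_image a) _.
  have wl F (sF : smooth_on (chart_image a.1) F) :
      smooth_on (chart_image a) (fun x => F (lsubmx x)).
    by apply: sl (smooth_on_lsubmx sF) => x /warped_image[].
  have wr F (sF : smooth_on (chart_image a.2) F) :
      smooth_on (chart_image a) (fun x => F (rsubmx x)).
    by apply: sl (smooth_on_rsubmx sF) => x /warped_image[].
  case: (split_ordP i) => i' ->; case: (split_ordP j) => j' ->.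
  + apply: (eq_on_smooth oS _ (wl _ (sm1 a.1 i' j'))) => x Sx.
    rewrite -warped_in_chart_l //; congr (in_chart 0 a _ x).
    by apply/funext => p; rewrite block_mxEul.
  + apply: (eq_on_smooth oS _ (@smooth_on_cst _ _ _ 0)) => x [p ap <-].
    by rewrite (warped_in_chart _ _ ap) block_mxEur mxE.
  + apply: (eq_on_smooth oS _ (@smooth_on_cst _ _ _ 0)) => x [p ap <-].
    by rewrite (warped_in_chart _ _ ap) block_mxEdl mxE.
  + have sf := wl _ (@fS a.1).
    apply: (eq_on_smooth oS _ (smooth_onM oS (smooth_onX 2 oS sf)
      (wr _ (sm2 a.2 i' j')))) => x Sx.
    rewrite -warped_in_chart_l // -warped_in_chart_r //.
    case: Sx => p ap <-; rewrite !(warped_in_chart _ _ ap).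
    by rewrite block_mxEdr mxE.
- move=> a b [p1 p2] ap bp.
  have Sp : overlap a b (chart_map a (p1, p2)) by exists (p1, p2).
  rewrite warped_jacobian //; case: ap bp => /= ap1 ap2 [/= bp1 bp2].
  rewrite row_mxKl row_mxKr tr_block_mx !trmx0 !mulmx_block.
  rewrite !mulmx0 !mul0mx !addr0 !add0r -!scalemxAr -!scalemxAl.
  by rewrite (tr1 _ _ _ ap1 bp1) (tr2 _ _ _ ap2 bp2) /= !mul0mx.
- exists (fun j => match fintype.split j with inl j1 => s1 j1 | inr j2 => s2 j2 end).
  move=> a [p1 p2] [/= ap1 ap2].
  have [P1 u1 e1] := ind1 _ _ ap1; have [P2 u2 e2] := ind2 _ _ ap2.
  (* Dividing the frame of the second factor by [f] absorbs [f ^+ 2], so at every point the signs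
     are those of the two factors side by side. *)
  exists (block_mx P1 0 0 ((f p1)^-1 *: P2)).
    rewrite unitmxE det_ublock unitrM -!unitmxE u1 /= unitmxZ //.
    by rewrite unitfE invr_eq0.
  rewrite tr_block_mx !trmx0 !mulmx_block !mulmx0 !mul0mx !addr0 !add0r.
  have e2' : (f p1)^-1 *: P2 *m (f p1 ^+ 2 *: chart_metric a.2 p2) *m
      ((f p1)^-1 *: P2)^T = diag_mx (\row_j (-1) ^+ s2 j).
    rewrite [X in _ *m X]linearZ /= -!scalemxAr -!scalemxAl !scalerA e2.
    by rewrite (_ : _ * _ * _ = 1) ?scale1r //; field; exact: f0.
  rewrite e1 e2' ?mul0mx.
  apply/matrixP => i j.
  case: (split_ordP i) => i' ->; case: (split_ordP j) => j' ->.
  + rewrite block_mxEul !mxE (inj_eq (@lshift_inj _ _)).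
    by have -> : fintype.split (lshift d2 i') = inl i' by exact: (unsplitK (inl i')).
  + by rewrite block_mxEur !mxE eq_lrshift.
  + by rewrite block_mxEdl !mxE eq_rlshift.
  + rewrite block_mxEdr !mxE (inj_eq (@rshift_inj _ _)).
    by have -> : fintype.split (rshift d1 i') = inr i' by exact: (unsplitK (inr i')).
Qed.

Lemma warped_semi_riemannian : is_semi_riemannian W.
Proof. by split; [exact: warped_manifold|exact: warped_metric]. Qed.

End WarpedProduct.

(** * The conformally flat base *)

Section ConformalFlat.
Variables (R : realType) (n : nat) (eps : 'I_n -> R) (U : set 'rV[R]_n).
Variable phi : 'rV[R]_n -> R.
Hypothesis oU : open U.

Local Notation M := (conformal_flat eps U phi).

(** An open set of the subspace is the trace on [U] of an open set [V] of the ambient space, and [U]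
    itself is open. *)
Lemma set_val_image (O : set (set_type U)) : open O ->
  open ((set_val : set_type U -> 'rV[R]_n) @` O).
Proof.
move=> [V oV VO]; have -> : set_val @` O = V `&` U.
  apply/seteqP; split=> [_ [x Ox <-]|x [Vx Ux]].
    by split; [rewrite -VO in Ox|exact: set_valP].
  by exists (exist _ x (mem_set Ux)) => //; rewrite -VO.
exact: openI.
Qed.

Lemma flat_image : chart_image (tt : chart M) = U.
Proof.
apply/seteqP; split=> [_ [x _ <-]|x Ux]; first exact: set_valP.
by exists (exist _ x (mem_set Ux)).
Qed.

Lemma flat_in_chart (V : choiceType) (v0 : V) (F : M -> V) (p : M) :
  in_chart v0 (tt : chart M) F (set_val p) = F p.
Proof.
apply: xget_unique; first by exists p.
by move=> _ [q [_ /= qp] <-]; congr F; exact: val_inj.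
Qed.

Lemma flat_manifold : is_manifold M.
Proof.
have tr x : U x -> transition (tt : chart M) (tt : chart M) x = x.
  by move=> Ux; exact: (flat_in_chart 0 _ (exist _ x (mem_set Ux))).
split.
- by apply: hausdorff_set_type; exact: norm_hausdorff.
- by apply: second_countable_set_type; exact: second_countable_rV.
- by move=> p; exists tt.
- case; split.
  + exact: openT.
  + by move=> p q _ _; exact: val_inj.
  + by apply: continuous_subspaceT; exact: set_val_continuous.
  + by move=> O oO _; exact: set_val_image.
- case; case => j; rewrite setIid -/(chart_image _) flat_image.
  have sj : smooth_on U (fun x : 'rV[R]_n => x 0 j).
    have sid : smooth1_on [set: R] id.
      move=> k t _; case: k => [|k]; first exact: derivable_id.
      rewrite derive1Sn (_ : derive1 id = cst 1); last first.
        by apply/funext => u; rewrite derive1_id.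
      have [c ->] : exists c : R, derive1n k (cst 1 : R -> R) = cst c.
        elim: k => [|k [c IH]]; first by exists 1.
        by exists 0; rewrite derive1nS IH; apply/funext => u; rewrite derive1_cst.
      exact: derivable_cst.
    (* The [j]-th coordinate is the linear form whose coefficients are those of a basis vector,
       composed with the identity. *)
    have sx := @smooth_on_xi R n (fun i => (i == j)%:R) setT id openT sid.
    have sU := smooth_on_subset (fun _ _ => Logic.I) sx.
    by apply: (eq_on_smooth oU _ (sU U)) => x _; rewrite /xi /= sum_delta.
  by apply: (eq_on_smooth oU _ sj) => x Ux; rewrite tr.
Qed.

Hypothesis heps : forall i, eps i = 1 \/ eps i = -1.
Hypothesis phi0 : forall x, U x -> phi x != 0.
Hypothesis phiS : smooth_on U phi.

Lemma eps_neq0 i : eps i != 0.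
Proof. by case: (heps i) => ->; rewrite ?oppr_eq0 oner_eq0. Qed.

Lemma unitmx_diag_eps : diag_mx (\row_i eps i) \in unitmx.
Proof.
rewrite unitmxE det_diag unitfE; apply/prodf_neq0 => i _.
by rewrite mxE eps_neq0.
Qed.

Lemma flat_metric : is_metric M.
Proof.
have phiP (p : set_type U) : phi (set_val p) != 0 by apply: phi0; exact: set_valP.
split.
- move=> a p _; split; first by rewrite /= linearZ /= tr_diag_mx.
  rewrite /= unitmxZ ?unitmx_diag_eps //.
  by rewrite unitfE invr_eq0 expf_neq0.
- case=> i j; rewrite -/(chart_image _) flat_image.
  have sV := smooth_onV oU _ (smooth_onX 2 oU phiS).
  have sE := smooth_onM oU (sV _) (@smooth_on_cst _ _ U (diag_mx (\row_i eps i) i j)).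
  apply: (eq_on_smooth oU _ (sE _)) => [x Ux|x Ux]; last first.
    by rewrite expf_neq0 // phi0.
  by rewrite (flat_in_chart 0 _ (exist _ x (mem_set Ux))) [RHS]mxE.
- case; case=> p _ _; set J := jacobian_matrix _ _.
  have -> : J = 1%:M.
    apply/matrixP => i j; rewrite !mxE.
    have Up : U (set_val p) by exact: set_valP.
    have E x : U x -> transition (tt : chart M) (tt : chart M) x 0 j =
        (id \o xi (fun i => (i == j)%:R)) x.
      move=> Ux; rewrite /transition (flat_in_chart 0 _ (exist _ x (mem_set Ux))).
      by rewrite /xi /= sum_delta.
    have -> := eq_on_partial i oU E Up.
    by rewrite partial_xi ?derive1_id ?mulr1.
  by cbv zeta; rewrite mul1mx trmx1 mulmx1.
- exists (fun j => eps j == -1); case=> p _.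
  (* Scaling the coordinate frame by [phi] cancels the conformal factor and leaves [diag(eps)]. *)
  exists (phi (set_val p))%:M; first by rewrite unitmxE det_scalar unitrX // unitfE.
  rewrite tr_scalar_mx mul_scalar_mx mul_mx_scalar !scalerA.
  rewrite (_ : _ * _ = 1) ?scale1r; last by field; exact: phiP.
  congr diag_mx; apply/matrixP => i j; rewrite !mxE.
  case: (heps j) => ->; last by rewrite eqxx expr1.
  have -> : (1 == -1 :> R) = false.
    by apply/negbTE; rewrite -subr_eq0 opprK -(natrD R 1 1) pnatr_eq0.
  by rewrite expr0.
Qed.

Lemma flat_semi_riemannian : is_semi_riemannian M.
Proof. by split; [exact: flat_manifold|exact: flat_metric]. Qed.

End ConformalFlat.

(** * Curvature of the sequential warped product *)

Section ProductSmooth.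
Variables (R : realType) (d1 d2 : nat).
Variables (O1 : set 'rV[R]_d1) (O2 : set 'rV[R]_d2).
Variables (A : 'rV[R]_d1 -> 'M[R]_d1) (B : 'rV[R]_d2 -> 'M[R]_d2).
Hypothesis oO1 : open O1.
Hypothesis oO2 : open O2.

Lemma smooth_on_product_metric :
  (forall i j, smooth_on O1 (fun x => A x i j)) ->
  (forall i j, smooth_on O2 (fun x => B x i j)) ->
  forall i j, smooth_on (product_dom O1 O2) (fun x => product_metric A B x i j).
Proof.
move=> sA sB i j.
case: (split_ordP i) => i' ->; case: (split_ordP j) => j' ->.
- rewrite product_metric_ll.
  by apply: smooth_on_subset (smooth_on_lsubmx (sA i' j')) => x [].
- by rewrite product_metric_lr; exact: smooth_on_cst.
- by rewrite product_metric_rl; exact: smooth_on_cst.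
- rewrite product_metric_rr.
  by apply: smooth_on_subset (smooth_on_rsubmx (sB i' j')) => x [].
Qed.

Lemma product_metric_sym x : (A (lsubmx x))^T = A (lsubmx x) ->
  (B (rsubmx x))^T = B (rsubmx x) ->
  (product_metric A B x)^T = product_metric A B x.
Proof. by move=> hA hB; rewrite tr_block_mx !trmx0 hA hB. Qed.

End ProductSmooth.

Lemma ricci_cst (R : realType) d (A : 'M[R]_d) x : ricci (fun=> A) x = 0.
Proof.
have G0 k i j : christoffel (fun=> A) k i j = fun=> 0.
  apply/funext => y; rewrite /christoffel big1 ?mulr0 // => l _.
  by rewrite !partial_cst addr0 subr0 mulr0.
apply/matrixP => j k; rewrite ricciE mxE /ricci_of.
rewrite !big1 ?addr0 // => i _.
  by rewrite big1 // => p _; rewrite !G0 !mul0r subr0.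
by rewrite !G0 !partial_cst subr0.
Qed.

Section SequentialProduct.
Variables (R : realType) (n m r : nat) (eps alpha : 'I_n -> R).
Hypothesis heps : forall i, eps i = 1 \/ eps i = -1.

(** [None] marks the base, the distinguished block [t0] on which [xi] lives; [Some false] and
    [Some true] mark the fibres [F1] and [F2]. *)
Definition factor (i : 'I_(n + m + r)) : option bool :=
  match fintype.split i with
  | inl j => match fintype.split j with inl _ => None | inr _ => Some false end
  | inr _ => Some true
  end.

Definition extend0 (v : 'I_n -> R) (i : 'I_(n + m + r)) : R :=
  match fintype.split i with
  | inl j => match fintype.split j with inl l => v l | inr _ => 0 end
  | inr _ => 0
  end.

Local Notation ix0 i := (lshift r (lshift m i)).
Local Notation ix1 i := (lshift r (rshift n i)).
Local Notation ix2 i := (rshift (n + m) i).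

Let splitl p q (i : 'I_p) : fintype.split (lshift q i) = inl i.
Proof. exact: (unsplitK (inl i)). Qed.

Let splitr p q (i : 'I_q) : fintype.split (rshift p i) = inr i.
Proof. exact: (unsplitK (inr i)). Qed.

Lemma factor0 i : factor (ix0 i) = None.
Proof. by rewrite /factor !splitl. Qed.

Lemma factor1 i : factor (ix1 i) = Some false.
Proof. by rewrite /factor splitl splitr. Qed.

Lemma factor2 i : factor (ix2 i) = Some true.
Proof. by rewrite /factor splitr. Qed.

Let factorE := (factor0, factor1, factor2).

Lemma extend0_0 v i : extend0 v (ix0 i) = v i.
Proof. by rewrite /extend0 !splitl. Qed.

Lemma extend0_1 v i : extend0 v (ix1 i) = 0.
Proof. by rewrite /extend0 splitl splitr. Qed.

Lemma extend0_2 v i : extend0 v (ix2 i) = 0.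
Proof. by rewrite /extend0 splitr. Qed.

Lemma extend0_factor v i : factor i != None -> extend0 v i = 0.
Proof.
case: (split_ordP i) => i' -> //; last by rewrite extend0_2.
case: (split_ordP i') => l ->; first by rewrite factor0.
by rewrite extend0_1.
Qed.

Lemma sum3 (F : 'I_(n + m + r) -> R) : \sum_i F i =
  \sum_(i < n) F (ix0 i) + \sum_(i < m) F (ix1 i) + \sum_(i < r) F (ix2 i).
Proof. by rewrite !big_split_ord. Qed.

Lemma sum_factor (F : option bool -> R) : \sum_i F (factor i) =
  n%:R * F None + m%:R * F (Some false) + r%:R * F (Some true).
Proof.
rewrite sum3; congr (_ + _ + _).
- under eq_bigr do rewrite factor0.
  by rewrite sumr_const card_ord mulr_natl.
- under eq_bigr do rewrite factor1.
  by rewrite sumr_const card_ord mulr_natl.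
- under eq_bigr do rewrite factor2.
  by rewrite sumr_const card_ord mulr_natl.
Qed.

Lemma sum_extend0 v (F : 'I_(n + m + r) -> R) :
  \sum_i extend0 v i * F i = \sum_(i < n) v i * F (ix0 i).
Proof.
rewrite sum3 [X in _ + X + _]big1 ?[X in _ + _ + X]big1 ?addr0.
- by apply: eq_bigr => i _; rewrite extend0_0.
- by move=> i _; rewrite extend0_2 mul0r.
- by move=> i _; rewrite extend0_1 mul0r.
Qed.

Lemma xi_extend0 x : xi (extend0 alpha) x = xi alpha (lsubmx (lsubmx x)).
Proof. by rewrite /xi sum_extend0; apply: eq_bigr => i _; rewrite !mxE. Qed.

Section Block.
Variables (G1 : 'rV[R]_m -> 'M[R]_m) (G2 : 'rV[R]_r -> 'M[R]_r).

Definition flat_block : 'rV[R]_(n + m + r) -> 'M[R]_(n + m + r) :=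
  product_metric (product_metric (fun=> diag_mx (\row_i eps i)) G1) G2.

Lemma flat_block_off x i j : factor i != factor j -> flat_block x i j = 0.
Proof.
rewrite /flat_block.
case: (split_ordP i) => i' ->; case: (split_ordP j) => j' ->.
- rewrite block_mxEul.
  by case: (split_ordP i') => u ->; case: (split_ordP j') => v ->;
    rewrite !factorE // => _; rewrite /product_metric ?block_mxEur ?block_mxEdl mxE.
- by rewrite block_mxEur mxE.
- by rewrite block_mxEdl mxE.
- by rewrite !factorE.
Qed.

Lemma partial_flat_block x a i j :
  factor a != factor i \/ factor i = None ->
  partial a (fun y => flat_block y i j) x = 0.
Proof.
rewrite /flat_block.
case: (split_ordP i) => i' ->; case: (split_ordP j) => j' ->.
- rewrite product_metric_ll.
  case: (split_ordP a) => a' ->; last first.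
    by move=> _; exact: (partial_lsubmx0 (fun y => product_metric _ G1 y i' j')).
  rewrite (partial_lsubmx (fun y => product_metric _ G1 y i' j')).
  case: (split_ordP i') => u ->; case: (split_ordP j') => v ->.
  + by rewrite product_metric_ll partial_cst.
  + by rewrite product_metric_lr partial_cst.
  + by rewrite product_metric_rl partial_cst.
  + rewrite factor1 => -[ai|//]; apply: partial_product_metric; left.
    move: ai; case: (split_ordP a') => w ->; rewrite ?factorE ?eqxx // => _.
    by rewrite side_lshift side_rshift.
- by rewrite product_metric_lr partial_cst.
- by rewrite product_metric_rl partial_cst.
- rewrite factor2 => -[ai|//]; apply: partial_product_metric; left.
  move: ai; case: (split_ordP a) => w ->; rewrite ?factorE ?eqxx // => _.
  by rewrite side_lshift side_rshift.
Qed.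

Lemma eps_sqr i : eps i * eps i = 1.
Proof. by case: (heps i) => ->; rewrite ?mulrNN mulr1. Qed.

(** [diag(eps)] is its own inverse because [eps] takes the values 1 and -1, so the gradient of [xi]
    has the components [eps i * alpha i]. *)
Lemma flat_block_raise x p :
  \sum_i extend0 (fun i => eps i * alpha i) i * flat_block x i p = extend0 alpha p.
Proof.
rewrite sum_extend0 /flat_block.
case: (split_ordP p) => p' ->; last first.
  by rewrite extend0_2 big1 // => i _; rewrite block_mxEur mxE mulr0.
case: (split_ordP p') => q ->; last first.
  by rewrite extend0_1 big1 // => i _; rewrite !block_mxEul block_mxEur mxE mulr0.
rewrite extend0_0 (bigD1 q) //= !block_mxEul !mxE eqxx mulr1n.
rewrite big1 ?addr0 => [|i iq]; last first.
  by rewrite !block_mxEul !mxE (negPf iq) mulr0n mulr0.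
by rewrite mulrAC eps_sqr mul1r.
Qed.

End Block.

Variables (F1 : metric_atlas R m) (F2 : metric_atlas R r).
Hypothesis hF1 : is_semi_riemannian F1.
Hypothesis hF2 : is_semi_riemannian F2.
Hypothesis flat1 : ricci_flat F1.
Hypothesis flat2 : ricci_flat F2.
Variables (I : set R) (f h phi : R -> R).
Hypothesis oI : open I.
Hypothesis sf : smooth1_on I f.
Hypothesis sh : smooth1_on I h.
Hypothesis sphi : smooth1_on I phi.

(** The admissible subset of the space is by definition the preimage of this set under [xi], so its
    openness can be checked in one variable. *)
Definition admissible_time : set R :=
  [set t | [/\ I t, 0 < f t, 0 < h t & phi t != 0]].

Local Notation I0 := admissible_time.
Local Notation U := (admissible_set alpha I f h phi).
Local Notation B := (conformal_flat eps U (phi \o xi alpha)).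
Local Notation f1 := (fun p : B => f (xi alpha (set_val p))).
Local Notation BF1 := (warped_product f1 F1).
Local Notation h1 := (fun q : BF1 => h (xi alpha (set_val q.1))).
Local Notation W := (sequential_product eps alpha F1 F2 I f h phi).

Lemma open_admissible_time : open I0.
Proof.
rewrite openE => t [It ft ht pt].
have nI : nbhs t I by exact: open_nbhs_nbhs.
have nP F (P : set R) : smooth1_on I F -> open P -> P (F t) -> nbhs t (F @^-1` P).
  move=> sF oP Pt; have c : {for t, continuous F}.
    by apply: derivable_continuous1; exact: (sF 0%N).
  exact: c P (open_nbhs_nbhs (conj oP Pt)).
have nf := nP f [set y | 0 < y] sf (@open_gt _ 0) ft.
have nh := nP h [set y | 0 < y] sh (@open_gt _ 0) ht.
have np := nP phi [set y | y != 0] sphi (@open_neq _ 0) pt.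
pose A := I `&` f @^-1` [set y | 0 < y].
pose C := h @^-1` [set y | 0 < y] `&` phi @^-1` [set y | y != 0].
have nAC : nbhs t (A `&` C) by apply: filterI; exact: filterI.
suff sub : A `&` C `<=` I0 by exact: filterS sub nAC.
by move=> s [[Is fs] [hs ps]]; split.
Qed.

Lemma open_admissible : open U.
Proof. exact: (open_xi open_admissible_time). Qed.

Let oU := open_admissible.

Lemma smooth_on_admissible F : smooth1_on I F -> smooth_on U (F \o xi alpha).
Proof.
by move=> sF; apply: smooth_on_subset (smooth_on_xi oI sF) => x [].
Qed.

Lemma base_semi_riemannian : is_semi_riemannian B.
Proof.
apply: flat_semi_riemannian => //; first by move=> x [].
exact: smooth_on_admissible.
Qed.

Lemma smooth_on_in_chart_flat F (a : chart B) : smooth1_on I F ->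
  smooth_on (chart_image a) (in_chart 0 a (fun p : B => F (xi alpha (set_val p)))).
Proof.
move=> sF; case: a; rewrite flat_image.
apply: (eq_on_smooth oU _ (smooth_on_admissible sF)) => x Ux.
by rewrite (flat_in_chart 0 _ (exist _ x (mem_set Ux))).
Qed.

Lemma BF1_semi_riemannian : is_semi_riemannian BF1.
Proof.
have [mB gB] := base_semi_riemannian; have [m1 g1] := hF1.
apply: warped_semi_riemannian => //.
  move=> p; have [_ fp _ _] : U (set_val p) by exact: set_valP.
  by rewrite gt_eqF.
by move=> a; exact: smooth_on_in_chart_flat.
Qed.

Lemma sequential_semi_riemannian : is_semi_riemannian W.
Proof.
have [mB gB] := base_semi_riemannian; have [m1 g1] := hF1.
have [mBF gBF] := BF1_semi_riemannian; have [m2 g2] := hF2.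
apply: warped_semi_riemannian => //.
  move=> p; have [_ _ hp _] : U (set_val p.1) by exact: set_valP.
  by rewrite gt_eqF.
move=> a; have oS := @open_chart_image _ _ _ mBF a.
have sl := smooth_on_lsubmx (d2 := m) (@smooth_on_in_chart_flat h a.1 sh).
have sS : smooth_on (chart_image a) _ := smooth_on_subset _ sl.
apply: (eq_on_smooth oS _ (sS _)) => x Sx; last by case: (warped_image Sx).
by rewrite (warped_in_chart_l mB m1 0 (fun p : B => h (xi alpha (set_val p))) Sx).
Qed.

(** What the three cases share. [om] collects the logarithmic derivatives of [f] and [h] and minus
    that of [phi], as [scale2] has [phi ^+ 2] in the denominator. [om_base] is minus the coefficient
    of [be j * be k] in the Ricci tensor, summed over the blocks with multiplicities [n], [m], [r];
    [om_fiber] is the other bracket, with the null direction as the alternative. *)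
Variable om : option bool -> R -> R.
Hypothesis om_phi : forall s, I0 s -> derive1 phi s = - (om None s * phi s).
Hypothesis om_f : forall s, I0 s -> derive1 f s = om (Some false) s * f s.
Hypothesis om_h : forall s, I0 s -> derive1 h s = om (Some true) s * h s.
Hypothesis omD : forall t s, I0 s -> derivable (om t) s 1.
Hypothesis om_base : forall s, I0 s ->
  (n%:R - 2) * (derive1 (om None) s - om None s ^+ 2)
  + m%:R * (derive1 (om (Some false)) s + om (Some false) s ^+ 2
            - 2 * om None s * om (Some false) s)
  + r%:R * (derive1 (om (Some true)) s + om (Some true) s ^+ 2
            - 2 * om None s * om (Some true) s) = 0.
Hypothesis om_fiber : forall t s, I0 s ->
  \sum_i eps i * alpha i ^+ 2 = 0 \/
  derive1 (om t) s + om t s * ((n%:R - 2) * om None s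
    + m%:R * om (Some false) s + r%:R * om (Some true) s) = 0.

Definition scale2 (t : option bool) (s : R) : R :=
  match t with
  | None => (phi s ^+ 2)^-1
  | Some false => f s ^+ 2
  | Some true => h s ^+ 2
  end.

Lemma scale2_neq0 t s : I0 s -> scale2 t s != 0.
Proof.
case=> _ fs hs ps; case: t => [[]|] /=.
- by rewrite expf_neq0 // gt_eqF.
- by rewrite expf_neq0 // gt_eqF.
- by rewrite invr_eq0 expf_neq0.
Qed.

Lemma is_derive_scale2 t s : I0 s ->
  is_derive s (1 : R) (scale2 t) (2 * scale2 t s * om t s).
Proof.
move=> I0s; have [Is fs hs ps] := I0s.
have df : is_derive s (1 : R) f ('D_1 f s) := derivableP (@sf 0%N _ Is).
have dh : is_derive s (1 : R) h ('D_1 h s) := derivableP (@sh 0%N _ Is).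
have dp : is_derive s (1 : R) phi ('D_1 phi s) := derivableP (@sphi 0%N _ Is).
rewrite -derive1E (om_f I0s) in df; rewrite -derive1E (om_h I0s) in dh.
rewrite -derive1E (om_phi I0s) in dp.
case: t => [[]|].
- have d2 := is_deriveM dh dh; have d3 : is_derive s (1 : R) (scale2 (Some true)) _ := d2.
  by apply: (is_derive_eq d3); rewrite /GRing.scale /=; ring.
- have d2 := is_deriveM df df; have d3 : is_derive s (1 : R) (scale2 (Some false)) _ := d2.
  by apply: (is_derive_eq d3); rewrite /GRing.scale /=; ring.
- have n2 : (phi * phi) s != 0 by exact: mulf_neq0.
  have d2 := is_deriveV n2 (is_deriveM dp dp).
  have d3 : is_derive s (1 : R) (scale2 None) _ := d2.
  apply: (is_derive_eq d3); rewrite /GRing.scale /= -[(phi * phi) s]/(phi s * phi s).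
  by field.
Qed.

Lemma sequential_ricci_flat : ricci_flat W.
Proof.
move=> a q aq.
have [m1 g1] := hF1; have [m2 g2] := hF2.
have [mB _] := base_semi_riemannian; have [mBF _] := BF1_semi_riemannian.
have [mW _] := sequential_semi_riemannian.
pose a1 := a.1.2; pose a2 := a.2.
pose G1 := in_chart 0 a1 (chart_metric a1); pose G2 := in_chart 0 a2 (chart_metric a2).
pose H := flat_block G1 G2.
pose E := fun _ : 'rV[R]_n => diag_mx (\row_i eps i).
(* Off the chart images [G1] and [G2] are default values; the product of the open images is a domain
   where all hypotheses on the blocks hold. *)
pose O12 := product_dom U (chart_image a1).
pose O := product_dom O12 (chart_image a2).
have oO12 : open O12.
  by apply: open_product_dom; [exact: oU|exact: (open_chart_image m1)].
have oO : open O.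
  by apply: open_product_dom; [exact: oO12|exact: (open_chart_image m2)].
have uE x : U x -> E x \in unitmx by move=> _; exact: unitmx_diag_eps.
have chartG d (M : metric_atlas R d) (b : chart M) : is_manifold M -> is_metric M ->
    [/\ forall x, chart_image b x -> in_chart 0 b (chart_metric b) x \in unitmx,
        forall x, chart_image b x ->
          (in_chart 0 b (chart_metric b) x)^T = in_chart 0 b (chart_metric b) x
      & forall i j, smooth_on (chart_image b)
          (fun x => in_chart 0 b (chart_metric b) x i j)].
  move=> mM [su sm _ _]; split.
  - by move=> _ [p bp <-]; rewrite (in_chartE mM _ _ bp); case: (su _ _ bp).
  - by move=> _ [p bp <-]; rewrite (in_chartE mM _ _ bp); case: (su _ _ bp).
  - move=> i j.
    apply: (eq_on_smooth (@open_chart_image _ _ _ mM b) _ (sm b i j)) => _ [p bp <-].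
    by rewrite !(in_chartE mM _ _ bp).
have [u1 y1 s1] := chartG _ _ a1 m1 g1; have [u2 y2 s2] := chartG _ _ a2 m2 g2.
have uP1 := @product_metric_unit _ _ _ _ _ _ _ uE u1.
have uH x : O x -> H x \in unitmx by exact: (product_metric_unit uP1 u2).
have symH x i j : O x -> H x i j = H x j i.
  move=> [[x0 x1] x2]; suff {1}<- : (H x)^T = H x by rewrite mxE.
  apply: product_metric_sym; last exact: y2.
  by apply: product_metric_sym; [rewrite tr_diag_mx|exact: y1].
have sE i j : smooth_on U (fun x => E x i j) by exact: smooth_on_cst.
have sH i j : smooth_on O (fun x => H x i j).
  exact: (smooth_on_product_metric (smooth_on_product_metric sE s1) s2).
have OI x : O x -> I0 (xi (extend0 alpha) x).
  by move=> [[x0 x1] x2]; rewrite xi_extend0.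
have SO x : chart_image a x -> O x.
  move=> [[[p p1] p2] [[_ /= ap1] /= ap2] <-]; split; last first.
    by rewrite /= row_mxKr; exists p2.
  rewrite /= row_mxKl; split; rewrite ?row_mxKl ?row_mxKr; first exact: set_valP.
  by exists p1.
have GW x : chart_image a x -> in_chart 0 a (chart_metric a) x =
    scaled_metric factor (extend0 alpha) H scale2 x.
  move=> [p ap <-]; rewrite (in_chartE mW _ _ ap).
  case: p ap => -[p p1] p2 [[_ /= ap1] /= ap2].
  have e1 : G1 (chart_map a1 p1) = chart_metric a1 p1 by exact: (in_chartE m1).
  have e2 : G2 (chart_map a2 p2) = chart_metric a2 p2 by exact: (in_chartE m2).
  apply/matrixP => i j; rewrite [RHS]mxE xi_extend0 /= !row_mxKl /H /flat_block.
  rewrite /product_metric !row_mxKl !row_mxKr e1 e2.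
  case: (split_ordP i) => i' ->; case: (split_ordP j) => j' ->.
  - rewrite !block_mxEul.
    case: (split_ordP i') => u ->; case: (split_ordP j') => v ->.
    + by rewrite !block_mxEul factor0 mxE.
    + by rewrite !block_mxEur mxE mulr0.
    + by rewrite !block_mxEdl mxE mulr0.
    + by rewrite !block_mxEdr factor1 mxE.
  - by rewrite !block_mxEur mxE mulr0.
  - by rewrite !block_mxEdl mxE mulr0.
  - by rewrite !block_mxEdr factor2 mxE.
have Sq : chart_image a (chart_map a q) by exists q.
have Oq := SO _ Sq.
rewrite /ricci_tensor (eq_on_ricci (@open_chart_image _ _ _ mW a) GW Sq).
set x := chart_map a q in Oq *.
(* The product formula, applied twice, splits [H] into the constant base block and the two fibres;
   here the Ricci-flatness of the fibres enters. *)
have RH : ricci H x = 0.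
  rewrite /H /flat_block (ricci_product oO12 (@open_chart_image _ _ _ m2 a2) uP1 u2 Oq).
  have [xO12 xO2] := Oq.
  rewrite (ricci_product oU (@open_chart_image _ _ _ m1 a1) uE u1 xO12) ricci_cst.
  have [_ [p1 ap1 e1]] := xO12; have [p2 ap2 e2] := xO2.
  by rewrite -e1 -e2 [ricci G1 _]flat1 // [ricci G2 _]flat2 // !block_mx0.
apply/matrixP => j k.
have RS := @ricci_scaled _ _ _ factor None (extend0 alpha)
  (extend0 (fun i => eps i * alpha i)) O I0 H scale2 om oO OI symH uH sH
  (fun y i j' _ => @flat_block_off G1 G2 y i j')
  (fun y b i j' _ => @partial_flat_block G1 G2 y b i j')
  (@extend0_factor alpha) (@extend0_factor _) (fun y p _ => flat_block_raise G1 G2 y p)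
  scale2_neq0 is_derive_scale2 omD x j k Oq.
rewrite RS.
rewrite RH [in RHS]mxE.
have Is := OI _ Oq; set s := xi _ x in Is *.
rewrite (sum_factor (fun t => om t s)) (sum_factor (fun t => derive1 (om t) s)).
rewrite (sum_factor (fun t => om t s ^+ 2)).
have -> : \sum_p extend0 alpha p * extend0 (fun i => eps i * alpha i) p =
    \sum_i eps i * alpha i ^+ 2.
  by rewrite sum_extend0; apply: eq_bigr => i _; rewrite extend0_0; ring.
set ee := \sum_i _.
have := om_base Is; set Z := (X in X = 0 -> _) => Z0.
(* The factor [ee] is kept so that the null case, where the bracket itself may be nonzero, is
   covered as well. *)
have fib : ee * (derive1 (om (factor j)) s + om (factor j) s *
   (n%:R * om None s + m%:R * om (Some false) s + r%:R * om (Some true) s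
    - 2 * om None s)) = 0.
  have [ee0|e0] := om_fiber (factor j) Is; first by rewrite /ee ee0 mul0r.
  by apply/eqP; rewrite mulf_eq0; apply/orP; right; rewrite -[X in _ == X]e0;
     apply/eqP; ring.
rewrite mxE add0r.
transitivity (- (extend0 alpha j * extend0 alpha k * Z)
  - H x j k * (scale2 (factor j) s / scale2 None s) *
  (ee * (derive1 (om (factor j)) s + om (factor j) s *
   (n%:R * om None s + m%:R * om (Some false) s + r%:R * om (Some true) s
    - 2 * om None s)))); first by rewrite /Z; ring.
by rewrite fib Z0 !mulr0 subr0 oppr0.
Qed.

End SequentialProduct.

(** * The three families of solutions *)

Section PowerFunctions.
Variables (R : realType) (D c : R).
Hypothesis D0 : D != 0.

Local Notation I := [set t : R | 0 < D * t + c].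

Lemma is_derive_affine (t : R) : is_derive t (1 : R) (fun s : R => D * s + c) D.
Proof. by apply: is_derive_eq; rewrite /GRing.scale /=; ring. Qed.

Lemma open_half_line : open I.
Proof.
apply: (@open_comp _ _ (fun t : R => D * t + c) [set y | 0 < y]).
  move=> t _; apply: derivable_continuous1.
  by have da := is_derive_affine t; exact: ex_derive.
exact: open_gt.
Qed.

Lemma is_derive_affine_powR (q t : R) : I t ->
  is_derive t (1 : R) (fun s : R => (D * s + c) `^ q)
    (q * D / (D * t + c) * (D * t + c) `^ q).
Proof.
move=> It; have dp := is_derive1_powR q It; have da := is_derive_affine t.
have h := @is_derive1_comp R (fun y : R => y `^ q) (fun s => D * s + c) t _ _ dp da.
have h' : is_derive t (1 : R) (fun s : R => (D * s + c) `^ q) _ := h.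
apply: (is_derive_eq h'); have u0 : D * t + c != 0 by rewrite gt_eqF.
rewrite /GRing.scale /= powRB ?u0 ?implybT // powRr1 ?ltW //.
by rewrite /GRing.scale /=; field.
Qed.

Lemma eq_on_derive1 (F G : R -> R) (t : R) : I t ->
  (forall s, I s -> F s = G s) -> derive1 F t = derive1 G t.
Proof.
move=> It FG; rewrite !derive1E; apply: near_eq_derive.
have nI : nbhs t I by apply: open_nbhs_nbhs; split; [exact: open_half_line|].
by apply: filterS nI.
Qed.

Lemma eq_on_derivable1 (F G : R -> R) (t : R) : I t ->
  (forall s, I s -> F s = G s) -> derivable F t 1 -> derivable G t 1.
Proof.
move=> It FG; apply: near_eq_derivable.
have nI : nbhs t I by apply: open_nbhs_nbhs; split; [exact: open_half_line|].
by apply: filterS nI.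
Qed.

Lemma power_derive1 (F : R -> R) (C q t : R) : I t ->
  (forall s, I s -> F s = C * (D * s + c) `^ q) ->
  derivable F t 1 /\ derive1 F t = q * D / (D * t + c) * F t.
Proof.
move=> It FE; have dp := is_derive_affine_powR q It.
have dC := is_deriveZ C dp; split.
  apply: (eq_on_derivable1 (F := C \*: (fun s : R => (D * s + c) `^ q)) It).
    by move=> s Is; rewrite FE.
  exact: ex_derive.
rewrite (@eq_on_derive1 _ (C \*: (fun s : R => (D * s + c) `^ q)) _ It FE).
rewrite derive1E (derive_val (f := C \*: _)) FE //.
by rewrite /GRing.scale /=; ring.
Qed.

(** Multiples of powers of the bracket are closed under differentiation: each derivative multiplies
    the constant by [q * D] and lowers the exponent by one. *)
Lemma power_smooth1 (F : R -> R) (C q : R) :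
  (forall s, I s -> F s = C * (D * s + c) `^ q) -> smooth1_on I F.
Proof.
move=> FE j t It.
suff [C' [q' E]] : exists C' q', forall s, I s ->
    derive1n j F s = C' * (D * s + c) `^ q' by case: (power_derive1 It E).
elim: j => [|j [C' [q' E]]]; first by exists C, q.
exists (C' * (q' * D)), (q' - 1) => s Is.
have u0 : D * s + c != 0 by rewrite gt_eqF.
rewrite derive1nS (power_derive1 Is E).2 E //.
by rewrite powRB ?u0 ?implybT // powRr1 ?ltW //; field.
Qed.

Lemma derive1_inverse_affine (w t : R) : I t ->
  derivable (fun s : R => w / (D * s + c)) t 1 /\
  derive1 (fun s : R => w / (D * s + c)) t = - (w * D) / (D * t + c) ^+ 2.
Proof.
move=> It; have u0 : D * t + c != 0 by rewrite gt_eqF.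
have dV := @is_deriveV R (fun s => D * s + c) t _ _ u0 (is_derive_affine t).
have h := is_deriveZ w dV.
have h' : is_derive t (1 : R) (fun s : R => w / (D * s + c)) _ := h.
split; first exact: ex_derive.
rewrite derive1E; have -> := @derive_val _ _ _ _ _ _ _ h'.
by rewrite /GRing.scale /=; field.
Qed.

End PowerFunctions.

(** The equation of case (C) divided by [- f h phi]. For [f] and [h] the sum [om' + om^2] is the
    second derivative over the function; for [phi], where [om] has the opposite sign, [om' - om^2]
    is minus that quotient. *)
Lemma base_equation (R : realType) (n m r f0 f1 f2 h0 h1 h2 p0 p1 p2 : R) :
  f0 != 0 -> h0 != 0 -> p0 != 0 ->
  - r * f0 * p0 * h2 - 2 * r * f0 * p1 * h1
    + ((n - 2) * f0 * p2 - m * p0 * f2 - 2 * m * p1 * f1) * h0 = 0 ->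
  (n - 2) * (- (p2 / p0 - (p1 / p0) ^+ 2) - (- p1 / p0) ^+ 2)
  + m * (f2 / f0 - (f1 / f0) ^+ 2 + (f1 / f0) ^+ 2 - 2 * (- p1 / p0) * (f1 / f0))
  + r * (h2 / h0 - (h1 / h0) ^+ 2 + (h1 / h0) ^+ 2 - 2 * (- p1 / p0) * (h1 / h0))
  = 0.
Proof.
move=> fn0 hn0 pn0 ode.
transitivity (- (- r * f0 * p0 * h2 - 2 * r * f0 * p1 * h1
    + ((n - 2) * f0 * p2 - m * p0 * f2 - 2 * m * p1 * f1) * h0)
  / (f0 * h0 * p0)); last by rewrite ode oppr0 mul0r.
by field; rewrite pn0 fn0 hn0.
Qed.

(** * Verification of the curvature equations in the cases (A), (B), (C) *)

Section Cases.
Variables (R : realType) (n m r : nat) (eps alpha : 'I_n -> R).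
Hypothesis heps : forall i, eps i = 1 \/ eps i = -1.
Variables (F1 : metric_atlas R m) (F2 : metric_atlas R r).
Hypothesis hF1 : is_semi_riemannian F1.
Hypothesis hF2 : is_semi_riemannian F2.
Hypothesis flat1 : ricci_flat F1.
Hypothesis flat2 : ricci_flat F2.
Variables (I : set R) (f h phi : R -> R).

Local Notation W := (sequential_product eps alpha F1 F2 I f h phi).

Lemma power_functions_ricci_flat (D N k c1 c2 c3 c : R) :
  let a := coef_a n m k in
  let b := coef_b n m k in
  D = a - r%:R * N ->
  r%:R * (r%:R - 1) * N ^+ 2 - 2 * r%:R * (k + a) * N + (a ^+ 2 - b) = 0 ->
  power_functions D N k c1 c2 c3 c I f h phi ->
  is_semi_riemannian W /\ ricci_flat W.
Proof.
move=> a b DE quad [D0 IE E].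
have [fE hE pE] : [/\ forall s, 0 < D * s + c -> f s = c1 * (D * s + c) `^ (- (1 / D)),
    forall s, 0 < D * s + c -> h s = c2 * (D * s + c) `^ (- (N / D)) &
    forall s, 0 < D * s + c -> phi s = c3 * (D * s + c) `^ (- (k / D))].
  by split=> s us; have [|? ? ?] := E s; rewrite ?IE.
have oI : open I by rewrite IE; exact: open_half_line.
have sf : smooth1_on I f by rewrite IE; exact: power_smooth1 fE.
have sh : smooth1_on I h by rewrite IE; exact: power_smooth1 hE.
have sp : smooth1_on I phi by rewrite IE; exact: power_smooth1 pE.
split; first exact: sequential_semi_riemannian.
pose w (t : option bool) : R :=
  match t with None => k | Some false => -1 | Some true => - N end.
pose om t s : R := w t / (D * s + c).
have u0 s : I s -> D * s + c != 0 by rewrite IE /= => us; rewrite gt_eqF.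
have dom t s : I s -> derivable (om t) s 1 /\
    derive1 (om t) s = - (w t * D) / (D * s + c) ^+ 2.
  by rewrite IE => us; exact: derive1_inverse_affine.
apply: (@sequential_ricci_flat _ _ _ _ eps alpha heps F1 F2 hF1 hF2 flat1 flat2
  I f h phi oI sf sh sp om).
- move=> s [Is _ _ _]; have us : 0 < D * s + c by rewrite IE in Is.
  rewrite (@power_derive1 R D c _ _ _ s us pE).2 /om /w; field.
  by rewrite D0 u0.
- move=> s [Is _ _ _]; have us : 0 < D * s + c by rewrite IE in Is.
  rewrite (@power_derive1 R D c _ _ _ s us fE).2 /om /w; field.
  by rewrite D0 u0.
- move=> s [Is _ _ _]; have us : 0 < D * s + c by rewrite IE in Is.
  rewrite (@power_derive1 R D c _ _ _ s us hE).2 /om /w; field.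
  by rewrite D0 u0.
- by move=> t s [Is _ _ _]; case: (dom t s Is).
- move=> s [Is _ _ _]; rewrite !(dom _ _ Is).2 /om /w.
  move: (D * s + c) (u0 _ Is) => u un0.
  (* All terms carry [1 / u ^+ 2]; inserting [D = a - r N] turns the numerator into minus the
     quadratic polynomial in [N]. *)
  transitivity (- (r%:R * (r%:R - 1) * N ^+ 2 - 2 * r%:R * (k + a) * N + (a ^+ 2 - b))
    / u ^+ 2); last by rewrite quad oppr0 mul0r.
  by rewrite DE /a /b /coef_a /coef_b; field.
- move=> t s [Is _ _ _]; right; rewrite (dom _ _ Is).2 /om.
  move: (D * s + c) (u0 _ Is) => u un0.
  (* The weights [k], [-1], [-N], with multiplicities [n - 2], [m], [r], add up to [a - r N], while
     the derivative of [w / u] brings [- D]. This forces the denominator [D] of the exponents, for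
     all blocks at once. *)
  transitivity (w t * (a - r%:R * N - D) / u ^+ 2); last first.
    by rewrite -DE subrr mulr0 mul0r.
  by rewrite /a /coef_a /=; field.
Qed.

Lemma case_A_ricci_flat : (1 <= r)%N -> case_A m r eps alpha I f h phi ->
  is_semi_riemannian W /\ ricci_flat W.
Proof.
move=> hr [k [c1 [c2 [c3 [c [sgn]]]]]] /=.
set a := coef_a n m k; set b := coef_b n m k; set N := N_pm r sgn k a b.
move=> [_ _ [r1 disc] hsgn pf].
apply: (power_functions_ricci_flat (N := N) erefl _ pf).
rewrite -/a -/b.
have r0 : (r%:R : R) != 0 by rewrite pnatr_eq0 -lt0n.
have rm1 : (r%:R - 1 : R) != 0.
  by rewrite subr_eq0 -[1]/(1%:R) eqr_nat; apply/eqP.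
set q := r%:R * (r%:R - 1).
have q0 : q != 0 by rewrite mulf_neq0.
pose X := r%:R * (k + a).
pose S := Num.sqrt (r%:R ^+ 2 * (k + a) ^+ 2 - q * (a ^+ 2 - b)).
have S2 : S ^+ 2 = X ^+ 2 - q * (a ^+ 2 - b).
  rewrite sqr_sqrtr /X; first by ring.
  have r_ge0 : (0 : R) <= r%:R by [].
  (* The radicand is [r] times the difference of the two sides of [disc]. *)
  have := ler_wpM2l r_ge0 disc; rewrite -subr_ge0 /q.
  by congr (0 <= _); ring.
have qN : q * N = X + sgn * S by rewrite /N /N_pm -/q -/S -/X mulrC divfK.
have s2 : sgn ^+ 2 = 1 by case: hsgn => ->; rewrite ?sqrrN expr1n.
(* After multiplication by [q] the quadratic is [(q N - X)^2 - X^2 + q (a^2 - b)], and [q N - X] is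
   [S] up to sign. *)
have : q * (q * N ^+ 2 - 2 * r%:R * (k + a) * N + (a ^+ 2 - b)) = 0.
  transitivity ((q * N) ^+ 2 - 2 * X * (q * N) + q * (a ^+ 2 - b)).
    by rewrite /X; ring.
  rewrite qN; transitivity (sgn ^+ 2 * S ^+ 2 - X ^+ 2 + q * (a ^+ 2 - b)).
    by ring.
  by rewrite s2 S2; ring.
by move/eqP; rewrite mulf_eq0 (negPf q0) => /eqP.
Qed.

(** For [r = 1] the leading coefficient [r (r - 1)] vanishes, and the quadratic becomes the linear
    equation [- 2 (k + a) N + a^2 - b = 0]. *)
Lemma case_B_ricci_flat : case_B m r eps alpha I f h phi ->
  is_semi_riemannian W /\ ricci_flat W.
Proof.
move=> [k [c1 [c2 [c3 [c]]]]] /=.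
set a := coef_a n m k; set b := coef_b n m k; set N := (_ / _).
move=> [_ _ r1 ka pf].
apply: (power_functions_ricci_flat (N := N) _ _ pf); first by rewrite r1 mul1r.
rewrite -/a -/b r1 /N; field.
exact: ka.
Qed.

(** For a null [alpha] the fibre bracket is multiplied by zero, so with [om] read off as logarithmic
    derivatives only the base equation remains, and it is the given differential equation. *)
Lemma case_C_ricci_flat : case_C m r eps alpha I f h phi ->
  is_semi_riemannian W /\ ricci_flat W.
Proof.
move=> [ee oI [sf sh sp] pos ode].
split; first exact: sequential_semi_riemannian.
pose om (t : option bool) s : R := match t with
  | None => - derive1 phi s / phi s
  | Some false => derive1 f s / f s
  | Some true => derive1 h s / h s end.
have dlog F s : smooth1_on I F -> I s -> F s != 0 ->
    is_derive s (1 : R) (fun t => derive1 F t / F t)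
      (derive1n 2 F s / F s - (derive1 F s / F s) ^+ 2).
  move=> sF Is F0.
  have d0 : is_derive s (1 : R) F ('D_1 F s) := derivableP (@sF 0%N _ Is).
  have d1 : is_derive s (1 : R) (derive1 F) ('D_1 (derive1 F) s) :=
    derivableP (@sF 1%N _ Is).
  have h' := is_deriveM d1 (is_deriveV F0 d0).
  have h2 : is_derive s (1 : R) (fun t => derive1 F t / F t) _ := h'.
  apply: (is_derive_eq h2); rewrite /GRing.scale /= -!derive1E.
  by field.
have dp s : I s -> phi s != 0 -> is_derive s (1 : R) (om None)
    (- (derive1n 2 phi s / phi s - (derive1 phi s / phi s) ^+ 2)).
  move=> Is p0; have dl := is_deriveN (dlog phi s sp Is p0).
  rewrite (_ : om None = - (fun t => derive1 phi t / phi t)) //.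
  by apply/funext => t; rewrite /om mulNr.
apply: (@sequential_ricci_flat _ _ _ _ eps alpha heps F1 F2 hF1 hF2 flat1 flat2
  I f h phi oI sf sh sp om).
- by move=> s [_ _ _ p0]; rewrite /om; field.
- by move=> s [_ f0 _ _]; rewrite /om divfK // gt_eqF.
- by move=> s [_ _ h0 _]; rewrite /om divfK // gt_eqF.
- move=> t s [Is f0 h0 p0]; case: t => [[]|].
  + by have dl := dlog h s sh Is (lt0r_neq0 h0); exact: ex_derive.
  + by have dl := dlog f s sf Is (lt0r_neq0 f0); exact: ex_derive.
  + by have dl := dp s Is p0; exact: ex_derive.
- move=> s [Is f0 h0 p0].
  have dh := dlog h s sh Is (lt0r_neq0 h0).
  have df := dlog f s sf Is (lt0r_neq0 f0).
  have dp0 := dp s Is p0.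
  have eh : derive1 (om (Some true)) s = _ := etrans (derive1E _ _) (@derive_val _ _ _ _ _ _ _ dh).
  have ef : derive1 (om (Some false)) s = _ := etrans (derive1E _ _) (@derive_val _ _ _ _ _ _ _ df).
  have ep : derive1 (om None) s = _ := etrans (derive1E _ _) (@derive_val _ _ _ _ _ _ _ dp0).
  rewrite eh ef ep /om.
  exact: (base_equation (lt0r_neq0 f0) (lt0r_neq0 h0) p0 (ode s Is)).
- by move=> t s _; left.
Qed.

End Cases.

Theorem corollary2p2 (R : realType) (n m r : nat)
    (hn : (3 <= n)%N) (hm : (1 <= m)%N) (hr : (1 <= r)%N)
    (eps alpha : 'I_n -> R) (heps : forall i, eps i = 1 \/ eps i = -1)
    (F1 : metric_atlas R m) (F2 : metric_atlas R r)
    (hF1 : is_semi_riemannian F1) (hF2 : is_semi_riemannian F2)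
    (flatF1 : einstein F1 /\ ricci_flat F1)
    (flatF2 : einstein F2 /\ ricci_flat F2)
    (I : set R) (f h phi : R -> R)
    (hcase : [\/ case_A m r eps alpha I f h phi,
                 case_B m r eps alpha I f h phi |
                 case_C m r eps alpha I f h phi]) :
  let W := sequential_product eps alpha F1 F2 I f h phi in
  [/\ is_semi_riemannian W, einstein W & ricci_flat W].
Proof.
move=> W; have [_ flat1] := flatF1; have [_ flat2] := flatF2.
suff [sW rW] : is_semi_riemannian W /\ ricci_flat W.
  (* Ricci-flatness is the Einstein condition with constant 0. *)
  by split=> //; exists 0 => a p ap; rewrite scale0r; exact: rW.
case: hcase => hc.
- exact: case_A_ricci_flat.
- exact: case_B_ricci_flat.
- exact: case_C_ricci_flat.
Qed.
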